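(* Let $\lambda/\mu$ be a connected r-shape, let $\mathbf a,\mathbf b$ be column flags for $\lambda/\mu$, and let $\Theta=(\theta_1,\ldots,\theta_k)$ be an outer ribbon decomposition of $\lambda/\mu$. For each $i,j\in[k]$ let $\mathbf a^{ij},\mathbf b^{ij}$ be the induced ribbon flags of $\theta_i\#\theta_j$. Then $$\mathsf S^{\mathbf a,\mathbf b}_{\lambda/\mu}(\mathbf y/\mathbf z)=\det\left[\mathsf S^{\mathbf a^{ij},\mathbf b^{ij}}_{\theta_i\#\theta_j}(\mathbf y/\mathbf z)\right]_{1\le i,j\le k},$$ where by convention the entry equals $1$ if $\theta_i\#\theta_j=\varnothing$ and equals $0$ if $\theta_i\#\theta_j$ is undefined.
   Context: Young diagrams are in English notation; a cell $(i,j)$ lies in row $i$ and column $j$, and $\mathrm{row}(\gamma),\mathrm{col}(\gamma)$ denote the row and column of a cell $\gamma$. $\lambda'$ is the conjugate partition. For partitions $\mu\subseteq\lambda$, $\lambda/\mu$ is the skew diagram $[\lambda]\setminus[\mu]$. An r-shape is a pair $(\lambda/\mu,r)$, $r\in\mathbb Z$, whose cells carry shifted contents $c(i,j)=j-i+r-1+\lambda'_1$ (so the bottom-left cell has content $r$, the ''root content''). It is connected if its diagram is edgewise connected. Column flags for an r-shape $\lambda/\mu$: for $n\ge\lambda_1$, vectors $\mathbf a=(a_i),\mathbf b=(b_i)\in\mathbb Z^n$ with $a_i-a_{i+1}\le\mu'_i-\mu'_{i+1}+1$ and $b_i-b_{i+1}\le\lambda'_i-\lambda'_{i+1}+1$ for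 every $i$ with $\mu'_i<\lambda'_{i+1}$. Their conjugate flags are $a'_i=a_i+c(\gamma_i)$, $b'_i=b_i+c(\delta_i)$, where $\gamma_i,\delta_i$ are the top and bottom cells of column $i$ (shifted contents). Variables $\mathbf y=(y_i)_{i\in\mathbb Z}$, $\mathbf z=(z_i)_{i\in\mathbb Z}$; $\mathbf y_{a,b}=(y_a,\ldots,y_b)$, empty if $a>b$. For variable sets $\mathbf x,\mathbf w$: $e_n(\mathbf x/\mathbf w)=\sum_{i=0}^n(-1)^{n-i}e_i(\mathbf x)h_{n-i}(\mathbf w)$, where $e_i,h_i$ are the elementary and complete homogeneous symmetric functions ($e_0=h_0=1$, and $e_n=0$ for $n<0$). The flagged supersymmetric Schur function is $\mathsf S^{\mathbf a,\mathbf b}_{\lambda/\mu}(\mathbf y/\mathbf z)=\det[e_{\lambda'_i-i-\mu'_j+j}(\mathbf y_{a_j,b_i}/\mathbf z_{a'_j,b'_i})]_{1\le i,j\le n}$. Ribbons: a ribbon is an edgewise connected skew diagram with no $2\times2$ block; its head is its bottom-left cell and its tail its top-right cell. A cell of $\lambda/\mu$ is on the top (right, bottom, left) perimeter if the cell directly above (right, below, left) is not in $\lambda/\mu$. An outer ribbon decomposition $\Theta=(\theta_1,\ldots,\theta_k)$ of $\lambda/\mu$ is a partition of its cells into ribbons such that each head lies on the left or bottom perimeter and each tail on the top or right perimeter. A cell $\gamma\in\theta_i$ goes up if the cell directly above $\gamma$ is in $\theta_i$, or $\gamma$ is the tail of $\theta_i$ and lies on the top perimeter; it goes right if the cell directly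 to its right is in $\theta_i$, or $\gamma$ is the tail of $\theta_i$ and lies on the right perimeter; the top-right cell of $\lambda/\mu$, lying in $\theta_i$, goes up if the cell directly below it is in $\theta_i$ and goes right if the cell directly to its left is in $\theta_i$. All cells of $\lambda/\mu$ with a given content go in the same direction. The cutting strip $\Theta(\lambda/\mu)$ is the ribbon whose cells have exactly the contents occurring in $\lambda/\mu$, the cell of content $c+1$ lying directly above (resp. directly right of) the cell of content $c$ when the cells of content $c$ in $\lambda/\mu$ go up (resp. right). For integers $p\le q$, $\Theta(p,q)$ is the sub-ribbon of the cutting strip consisting of cells with contents in $[p,q]$, regarded as an r-shape with root content $p$; $\Theta(p,q)=\varnothing$ if $p=q+1$, and $\Theta(p,q)$ is undefined if $p>q+1$. Define $\theta_i\#\theta_j=\Theta(c(\delta_i),c(\gamma_j))$, where $\delta_i$ is the head of $\theta_i$ and $\gamma_j$ the tail of $\theta_j$. Canonical decomposition: a ribbon $\theta$ is written $\theta=\rho_1\to\cdots\to\rho_K$, where $\rho_1,\ldots,\rho_K$ are vertical strips (its maximal column segments, from left to right) and $D_1\to D_2$ means placing the bottom-left cell of $D_2$ directly to the right of the top-right cell of $D_1$. Induced ribbon flags: if $\theta_i\#\theta_j=\rho_1\to\cdots\to\rho_K$ is nonempty and defined, let $\delta_r,\gamma_r$ be the bottom and top cells of $\rho_r$, let $M_r$ be the rightmost cell of $\lambda/\mu$ with content $c(\delta_r)$ and $m_r$ the leftmost cell of $\lambda/\mu$ with content $c(\gamma_r)$ (rows and columns measured in $\lambda/\mu$). Then $a^{ij}_r=a_{\mathrm{col}(m_r)}-(\mu'_{\mathrm{col}(m_r)}+1)+\mathrm{row}(m_r)$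 and $b^{ij}_r=b_{\mathrm{col}(M_r)}-\lambda'_{\mathrm{col}(M_r)}+\mathrm{row}(M_r)$, $r\in[K]$; these serve as column flags of the r-shape $\theta_i\#\theta_j$ (whose conjugate flags are computed with its shifted contents). *)

(* Defs.v *)
From HB Require Import structures.
From mathcomp Require Import all_boot all_order all_algebra.
Set Implicit Arguments. Unset Strict Implicit. Unset Printing Implicit Defensive.
Import Order.TTheory GRing.Theory Num.Theory.
Local Open Scope ring_scope.

(* Cells, partitions, skew diagrams (English notation, 1-indexed rows/cols) *)

Definition cell := (nat * nat)%type.
Definition row (c : cell) : nat := c.1.
Definition col (c : cell) : nat := c.2.

Definition is_partition (lam : seq nat) : bool :=
  sorted geq lam && all (fun x => 0 < x)%N lam.

Definition part (lam : seq nat) (i : nat) : nat := nth 0%N lam i.-1.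

Definition conj (lam : seq nat) (j : nat) : nat := count (fun x => j <= x)%N lam.

Definition conjseq (s : seq nat) : seq nat :=
  [seq conj s j | j <- iota 1 (head 0%N s)].

Definition subpart (mu lam : seq nat) : Prop := forall i, (part mu i <= part lam i)%N.

Definition in_skew (lam mu : seq nat) (c : cell) : bool :=
  [&& (0 < row c)%N, (0 < col c)%N, (col c <= part lam (row c))%N
    & ~~ (col c <= part mu (row c))%N].

Definition skew_cells (lam mu : seq nat) : seq cell :=
  [seq c <- flatten [seq [seq (i, j) | j <- iota 1 (part lam i)] | i <- iota 1 (size lam)]
  | in_skew lam mu c].

Definition above (c : cell) : cell := (c.1.-1, c.2).
Definition below (c : cell) : cell := (c.1.+1, c.2).
Definition leftc (c : cell) : cell := (c.1, c.2.-1).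
Definition rightc (c : cell) : cell := (c.1, c.2.+1).

Definition adj (c d : cell) : bool :=
  ((c.1 == d.1) && ((c.2 == d.2.+1) || (d.2 == c.2.+1))) ||
  ((c.2 == d.2) && ((c.1 == d.1.+1) || (d.1 == c.1.+1))).

Definition edge_connected (P : pred cell) : Prop :=
  forall c d, P c -> P d ->
    exists p : seq cell, [/\ all P p, path adj c p & last c p = d].

Definition is_skew_diagram (S : seq cell) : Prop :=
  exists lam mu : seq nat, [/\ is_partition lam, is_partition mu, subpart mu lam &
    forall c, (c \in S) = in_skew lam mu c].

Definition no_2x2 (S : seq cell) : Prop :=
  forall i j, ~ [/\ (i, j) \in S, (i.+1, j) \in S, (i, j.+1) \in S & (i.+1, j.+1) \in S].

Definition is_ribbon (S : seq cell) : Prop :=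
  [/\ S != [::], is_skew_diagram S, edge_connected (mem S) & no_2x2 S].

Definition best (better : cell -> cell -> bool) (L : seq cell) : cell :=
  foldl (fun acc x => if better x acc then x else acc) (head (0%N, 0%N) L) L.

Definition bottom_left (L : seq cell) : cell :=
  best (fun x acc => (acc.1 < x.1)%N || ((x.1 == acc.1) && (x.2 < acc.2)%N)) L.
Definition top_right (L : seq cell) : cell :=
  best (fun x acc => (x.1 < acc.1)%N || ((x.1 == acc.1) && (acc.2 < x.2)%N)) L.

Definition rib_head (th : seq cell) : cell := bottom_left th.
Definition rib_tail (th : seq cell) : cell := top_right th.

Definition top_perim lam mu c := ~~ in_skew lam mu (above c).
Definition right_perim lam mu c := ~~ in_skew lam mu (rightc c).
Definition bottom_perim lam mu c := ~~ in_skew lam mu (below c).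
Definition left_perim lam mu c := ~~ in_skew lam mu (leftc c).

Definition content (lam : seq nat) (r : int) (c : cell) : int :=
  (col c)%:Z - (row c)%:Z + r - 1 + (conj lam 1)%:Z.

Definition outer_ribbon_decomposition (lam mu : seq nat) (Th : seq (seq cell)) : Prop :=
  [/\ forall th, th \in Th -> is_ribbon th,
      forall c, in_skew lam mu c = has (fun th => c \in th) Th,
      forall i j, (i < size Th)%N -> (j < size Th)%N -> i <> j ->
        forall c, c \in nth [::] Th i -> c \notin nth [::] Th j,
      forall th, th \in Th ->
        left_perim lam mu (rib_head th) || bottom_perim lam mu (rib_head th) &
      forall th, th \in Th ->
        top_perim lam mu (rib_tail th) || right_perim lam mu (rib_tail th)].

Definition goes_up (lam mu : seq nat) (th : seq cell) (g : cell) : bool :=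
  if g == top_right (skew_cells lam mu) then below g \in th
  else (above g \in th) || ((g == rib_tail th) && top_perim lam mu g).

Definition goes_right (lam mu : seq nat) (th : seq cell) (g : cell) : bool :=
  if g == top_right (skew_cells lam mu) then leftc g \in th
  else (rightc g \in th) || ((g == rib_tail th) && right_perim lam mu g).

(* the cells of content c in lam/mu go up (they all go in the same
   direction; we test whether some cell of content c goes up) *)
Definition content_goes_up (lam mu : seq nat) (r : int) (Th : seq (seq cell)) (c : int) : bool :=
  has (fun g => (content lam r g == c) &&
                has (fun th => (g \in th) && goes_up lam mu th g) Th)
      (skew_cells lam mu).

Definition zrange (a b : int) : seq int :=
  if a <= b then [seq a + (k%:Z) | k <- iota 0 (absz (b - a)).+1] else [::].

(* Canonical decomposition of the sub-ribbon Theta(p,q) (p <= q) of the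
   cutting strip: the contents of the tops and bottoms of its vertical
   strips rho_1, ..., rho_K, from left to right. *)
Definition strip_rights lam mu r Th (p q : int) : seq int :=
  [seq c <- zrange p (q - 1) | ~~ content_goes_up lam mu r Th c].
Definition strip_tops lam mu r Th (p q : int) : seq int :=
  rcons (strip_rights lam mu r Th p q) q.
Definition strip_bots lam mu r Th (p q : int) : seq int :=
  p :: [seq c + 1 | c <- strip_rights lam mu r Th p q].
Definition strip_K lam mu r Th (p q : int) : nat := size (strip_tops lam mu r Th p q).

(* Theta(p,q) as an r-shape (root content p), placed with its columns
   1..K: column k has bottom row lam'_k and top row mu'_k + 1. *)
Definition strip_height lam mu r Th (p q : int) : int :=
  q - p + 2 - (strip_K lam mu r Th p q)%:Z.
Definition strip_lamc lam mu r Th (p q : int) : seq nat :=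
  [seq absz (k%:Z - nth 0 (strip_bots lam mu r Th p q) k.-1 + p - 1
          + strip_height lam mu r Th p q) | k <- iota 1 (strip_K lam mu r Th p q)].
Definition strip_muc lam mu r Th (p q : int) : seq nat :=
  [seq absz (k%:Z - nth 0 (strip_tops lam mu r Th p q) k.-1 + p - 2
          + strip_height lam mu r Th p q) | k <- iota 1 (strip_K lam mu r Th p q)].
Definition strip_lam lam mu r Th p q := conjseq (strip_lamc lam mu r Th p q).
Definition strip_mu lam mu r Th p q := conjseq (strip_muc lam mu r Th p q).

Definition rightmost_of_content lam mu r (c : int) : cell :=
  best (fun x acc => (acc.2 < x.2)%N) [seq g <- skew_cells lam mu | content lam r g == c].
Definition leftmost_of_content lam mu r (c : int) : cell :=
  best (fun x acc => (x.2 < acc.2)%N) [seq g <- skew_cells lam mu | content lam r g == c].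

Definition induced_a lam mu r Th (a : nat -> int) (p q : int) (k : nat) : int :=
  let m := leftmost_of_content lam mu r (nth 0 (strip_tops lam mu r Th p q) k.-1) in
  a (col m) - ((conj mu (col m))%:Z + 1) + (row m)%:Z.
Definition induced_b lam mu r Th (b : nat -> int) (p q : int) (k : nat) : int :=
  let M := rightmost_of_content lam mu r (nth 0 (strip_bots lam mu r Th p q) k.-1) in
  b (col M) - (conj lam (col M))%:Z + (row M)%:Z.

Fixpoint esym (R : comNzRingType) (s : seq R) (k : nat) : R :=
  match s with
  | [::] => (k == 0%N)%:R
  | x :: s' => esym s' k + (if k is k'.+1 then x * esym s' k' else 0)
  end.

Fixpoint hsym (R : comNzRingType) (s : seq R) (k : nat) : R :=
  match s with
  | [::] => (k == 0%N)%:R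
  | x :: s' => \sum_(m < k.+1) x ^+ m * hsym s' (k - m)
  end.

Definition esup (R : comNzRingType) (x w : seq R) (n : int) : R :=
  match n with
  | Posz m => \sum_(i < m.+1) (-1) ^+ (m - i) * esym x i * hsym w (m - i)
  | Negz _ => 0
  end.

Definition column_flags (lam mu : seq nat) (n : nat) (a b : nat -> int) : Prop :=
  (part lam 1 <= n)%N /\
  forall i, (1 <= i < n)%N -> (conj mu i < conj lam i.+1)%N ->
    a i - a i.+1 <= (conj mu i)%:Z - (conj mu i.+1)%:Z + 1 /\
    b i - b i.+1 <= (conj lam i)%:Z - (conj lam i.+1)%:Z + 1.

(* top cell gamma_i = (mu'_i + 1, i) and bottom cell delta_i = (lam'_i, i)
   of column i, and conjugate flags *)
Definition conj_flag_a (lam mu : seq nat) (r : int) (a : nat -> int) (i : nat) : int :=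
  a i + content lam r ((conj mu i).+1, i).
Definition conj_flag_b (lam mu : seq nat) (r : int) (b : nat -> int) (i : nat) : int :=
  b i + content lam r (conj lam i, i).

Definition flaggedS (R : comNzRingType) (y z : int -> R) (lam mu : seq nat) (r : int)
    (n : nat) (a b : nat -> int) : R :=
  \det (\matrix_(i < n, j < n)
     esup [seq y t | t <- zrange (a j.+1) (b i.+1)]
          [seq z t | t <- zrange (conj_flag_a lam mu r a j.+1) (conj_flag_b lam mu r b i.+1)]
          ((conj lam i.+1)%:Z - (i.+1)%:Z - (conj mu j.+1)%:Z + (j.+1)%:Z)).

(* the (i,j) entry: S^{a^{ij},b^{ij}}_{th_i # th_j}(y/z), with the
   conventions 1 if th_i # th_j is empty and 0 if it is undefined *)
Definition ribbon_entry (R : comNzRingType) (y z : int -> R) (lam mu : seq nat) (r : int)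
    (Th : seq (seq cell)) (a b : nat -> int) (thi thj : seq cell) : R :=
  let p := content lam r (rib_head thi) in
  let q := content lam r (rib_tail thj) in
  if p == q + 1 then 1
  else if q + 1 < p then 0
  else flaggedS y z (strip_lam lam mu r Th p q) (strip_mu lam mu r Th p q) p
         (strip_K lam mu r Th p q)
         (induced_a lam mu r Th a p q) (induced_b lam mu r Th b p q).

(* Main.v *)
Require Import Defs.
From HB Require Import structures.
From mathcomp Require Import all_boot all_order all_algebra.
From mathcomp Require Import fingroup perm zify ring.
Import Order.TTheory GRing.Theory Num.Theory.
Local Open Scope ring_scope.

(* Write E s t for the entry of a flagged Jacobi-Trudi matrix attached to a
   vertical strip which starts on diagonal s and whose top cell is on diagonal
   t - 1.  The induced flags depend on contents only, so a single unitriangular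
   kernel E serves both the shape and all the ribbons; nothing else about the
   flags or the symmetric functions matters.

   Sweep the diagonals of the shape from its bottom-left to its top-right cell.
   Both the columns and the ribbons of the decomposition are strands crossing
   each diagonal once per cell.  On reaching diagonal w: if the cells of the
   previous diagonal go up, columns and ribbons undergo the same change; if
   they go right, a column ends (resp. starts) at w exactly when no ribbon
   starts (resp. ends) there, and the ribbon entries change by
   R'(p, x) = R(p, w) E(w, x) - R(p, x).  The invariant is that the determinant
   built from the columns and the one built from the ribbons agree for every
   choice of the end points of the strands still crossing the current diagonal.
   Keeping these strands ordered from top to bottom makes the sign of the
   permutation of the strands cancel the sign in R' at each step. *)

Set Implicit Arguments.
Unset Strict Implicit.
Unset Printing Implicit Defensive.

(** * Determinants indexed by a list of (row, column) pairs *)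

Section Dlist.
Variable R : comNzRingType.
Implicit Types (K : nat -> nat -> R) (L : seq (nat * nat)).

Definition dmx K n L : 'M[R]_n :=
  \matrix_(i < n, j < n) K (nth (0%N, 0%N) L i).1 (nth (0%N, 0%N) L j).2.

(** First components index the rows, second components the columns. Reordering the pairs changes
    nothing, while re-pairing starts with ends costs the sign of the permutation; the sign
    bookkeeping of the sweep rests on this. *)
Definition dlist K L : R := \det (dmx K (size L) L).

Lemma eq_dlist K K' L :
  {in map fst L & map snd L, forall p x, K p x = K' p x} -> dlist K L = dlist K' L.
Proof.
move=> eqK; congr (\det _); apply/matrixP=> i j; rewrite !mxE.
by apply: eqK; rewrite -?(nth_map _ 0%N) ?mem_nth ?size_map.
Qed.

Lemma dlist_nil K : dlist K [::] = 1.
Proof. exact: det_mx00. Qed.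

Lemma dlist1 K c : dlist K [:: c] = K c.1 c.2.
Proof. by rewrite /dlist det_mx11 mxE. Qed.

Lemma dlist_perm K L L' : perm_eq L L' -> dlist K L = dlist K L'.
Proof.
move=> pLL'; rewrite /dlist (perm_size pLL').
have [s def_s] : exists s : 'S_(size L'), forall i : 'I_(size L'),
    nth (0%N, 0%N) L i = nth (0%N, 0%N) L' (s i).
  have sz := perm_size pLL'.
  have /tuple_permP[s def_s] : perm_eq (tcast sz (in_tuple L)) (in_tuple L').
    by rewrite val_tcast.
  exists s => i; move/(congr1 (nth (0%N, 0%N) ^~ i)): def_s.
  rewrite val_tcast /= => ->; rewrite (nth_map i) ?size_enum_ord //.
  by rewrite nth_ord_enum (tnth_nth (0%N, 0%N)).
have ->: dmx K (size L') L = row_perm s (col_perm s (dmx K (size L') L')).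
  by apply/matrixP=> i j; rewrite !mxE !def_s.
(* The same permutation acts on rows and columns, so its sign occurs twice. *)
rewrite row_permE col_permE !det_mulmx !det_perm.
by rewrite odd_permV [X in _ * X]mulrC mulrA -signr_addb addbb mul1r.
Qed.

Lemma dlist_tr K L :
  dlist K L = dlist (fun x p => K p x) [seq (c.2, c.1) | c <- L].
Proof.
rewrite /dlist size_map -[LHS]det_tr; congr (\det _).
by apply/matrixP=> i j; rewrite !mxE !(nth_map (0%N, 0%N)) ?ltn_ord.
Qed.

Lemma dlist_scale (e : nat -> R) K L :
  dlist (fun p x => e x * K p x) L = (\prod_(c <- L) e c.2) * dlist K L.
Proof.
rewrite /dlist.
pose d := \row_(j < size L) e (nth (0%N, 0%N) L j).2.
have ->: dmx (fun p x => e x * K p x) (size L) L = dmx K (size L) L *m diag_mx d.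
  by apply/matrixP=> i j; rewrite mul_mx_diag !mxE mulrC.
rewrite det_mulmx det_diag mulrC; congr (_ * _).
rewrite (big_nth (0%N, 0%N)) big_mkord; apply: eq_bigr => i _; by rewrite mxE.
Qed.

Lemma dmx_cons K c L :
  dmx K (size (c :: L)) (c :: L) =
  block_mx (K c.1 c.2)%:M (\row_j K c.1 (nth (0%N, 0%N) L j).2)
     (\col_i K (nth (0%N, 0%N) L i).1 c.2) (dmx K (size L) L) :> 'M_(1 + size L).
Proof.
apply/matrixP=> i j; rewrite !mxE.
case: (split_ordP i) => i' ->; rewrite !mxE; case: (split_ordP j) => j' ->; rewrite !mxE /=;
 by rewrite ?(ord1 i') ?(ord1 j') // ?(ord1 i') ?(ord1 j') //= ?mulr1n.
Qed.

(** Block elimination against the unit pivot leaves its Schur complement. *)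
Lemma dlist_pivot K w x L : K w x = 1 ->
  dlist K ((w, x) :: L) = dlist (fun p q => K p q - K p x * K w q) L.
Proof.
move=> Kwx; rewrite /dlist dmx_cons /= Kwx.
set r := \row_j _; set c := \col_i _; set M := dmx K _ L.
have ->: \det (block_mx 1%:M r c M : 'M_(1 + size L)) = \det (M - c *m r).
  have ->: block_mx 1%:M r c M = block_mx 1%:M 0 c 1%:M *m block_mx 1%:M r 0 (M - c *m r).
    by rewrite mulmx_block !mul1mx !mul0mx ?mulmx0 !mulmx1 !addr0 addrC subrK.
  by rewrite det_mulmx det_lblock det_ublock !det1 !mul1r.
congr (\det _).
by apply/matrixP=> i j; rewrite !mxE big_ord1 !mxE.
Qed.

(** A column operation adding multiples of column [w] to the others. Since [b w = 0], column [w]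
    itself is kept and the operation is right multiplication by a unitriangular matrix. *)
Lemma dlist_addcol (b : nat -> R) K p w L : b w = 0 ->
  dlist (fun q x => K q x + b x * K q w) ((p, w) :: L) = dlist K ((p, w) :: L).
Proof.
move=> bw; rewrite /dlist !dmx_cons /= bw mul0r addr0.
set r := \row_j K _ _; set c := \col_i K _ _; set M := dmx K _ L.
pose bb := \row_(j < size L) b (nth (0%N, 0%N) L j).2.
have Dbb: \det (block_mx 1%:M bb 0 1%:M : 'M_(1 + size L)) = 1.
  by rewrite det_ublock !det1 mulr1.
rewrite -[RHS]mulr1 -Dbb -(@det_mulmx R (1 + size L)) mulmx_block !mulmx1 !mulmx0 !addr0.
apply: (congr1 (fun A : 'M_(1 + size L) => \det A)).
congr (@block_mx _ 1 (size L) 1 (size L) _ _ _ _).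
- by apply/matrixP=> i j; rewrite !mxE mulrC big_ord1 !mxE !ord1 eqxx mulr1n addrC.
- by apply/matrixP=> i j; rewrite !mxE mul0r addr0.
- by apply/matrixP=> i j; rewrite !mxE big_ord1 !mxE addrC mulrC.
Qed.

Lemma dlist_addrow (a : nat -> R) K w x L : a w = 0 ->
  dlist (fun p q => K p q + a p * K w q) ((w, x) :: L) = dlist K ((w, x) :: L).
Proof. by move=> aw; rewrite dlist_tr [RHS]dlist_tr /= (@dlist_addcol _ (fun x p => K p x)). Qed.

Lemma dlist_swap K a b x y L :
  dlist K [:: (a, x), (b, y) & L] = - dlist K [:: (a, y), (b, x) & L].
Proof.
rewrite /dlist; set n := (size L).+2.
have e01 : Ordinal (isT : (0 < n)%N) != Ordinal (isT : (1 < n)%N) by [].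
have ->: dmx K n [:: (a, y), (b, x) & L] =
   xcol (Ordinal (isT : (0 < n)%N)) (Ordinal (isT : (1 < n)%N)) (dmx K n [:: (a, x), (b, y) & L]).
  apply/matrixP=> i j; rewrite !mxE; congr (K _ _).
    by case: i => [[|[|i]]].
  case: tpermP => [->|->|] //; case: j => [[|[|j]] ltj] //= n0 n1; [case: n0|case: n1]; exact: val_inj.
by rewrite xcolE det_mulmx det_perm odd_tperm e01 expr1 mulrN1 opprK.
Qed.

(** Carrying the end [w] past all of [xs] takes [size xs] adjacent swaps, each changing the sign. *)
Lemma dlist_rot_target K A w xs F : size A = (size xs).+1 ->
  dlist K (zip A (w :: xs) ++ F) = (-1) ^+ size xs * dlist K (zip A (rcons xs w) ++ F).
Proof.
elim: xs A F => [|x xs IH] [//|a [|b A]] F //= => [_|[szA]].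
  by rewrite expr0 mul1r.
rewrite dlist_swap exprS -mulrA mulN1r; congr (- _).
have := IH (b :: A) ((a, x) :: F); rewrite /= szA => /(_ erefl) IH'.
rewrite (@dlist_perm _ _ ((b, w) :: zip A xs ++ (a, x) :: F)).
  rewrite IH'; congr (_ * _); apply: dlist_perm.
  by apply/seq.permP=> P; rewrite /= !count_cat /=; lia.
by apply/seq.permP=> P; rewrite /= !count_cat /=; lia.
Qed.

Lemma dlist_rot_source K A w xs F : size xs = (size A).+1 ->
  dlist K (zip (w :: A) xs ++ F) = (-1) ^+ size A * dlist K (zip (rcons A w) xs ++ F).
Proof.
move=> szx; rewrite !(@dlist_tr K) !map_cat.
have zs B ys : [seq (c.2, c.1) | c <- zip B ys] = zip ys B :> seq (nat * nat).
  by elim: B ys => [|b B IH] [|y ys] //=; rewrite IH.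
by rewrite !zs dlist_rot_target.
Qed.

(** The hypothesis says that the lower left block vanishes. *)
Lemma dlist_cat K L1 L2 : (forall c d, c \in L2 -> d \in L1 -> K c.1 d.2 = 0) ->
  dlist K (L1 ++ L2) = dlist K L1 * dlist K L2.
Proof.
move=> K0; rewrite /dlist size_cat -(@det_ublock _ _ _ _
  (\matrix_(i, j) K (nth (0%N, 0%N) L1 i).1 (nth (0%N, 0%N) L2 j).2)).
congr (\det _); apply/matrixP => i j; rewrite !mxE.
case: (split_ordP i) => i' ->; rewrite !mxE; case: (split_ordP j) => j' ->;
  rewrite !mxE /= !nth_cat ?ltn_ord ?(ltnNge (_ + _)) ?leq_addr ?addKn //=.
by rewrite K0 // mem_nth.
Qed.

Definition retarget L j x := set_nth (0%N, 0%N) L j ((nth (0%N, 0%N) L j).1, x).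

(** Laplace expansion along row [w]. In the minor that omits the end of the [j]-th pair, column [x]
    comes first; moving it to place [j] absorbs the cofactor sign and gives the matrix with that end
    replaced by [x]. *)
Lemma dlist_cramer K w x L :
  dlist K ((w, x) :: L) = K w x * dlist K L -
    \sum_(j < size L) K w (nth (0%N, 0%N) L j).2 * dlist K (retarget L j x).
Proof.
rewrite {1}/dlist /= (expand_det_row _ ord0) big_ord_recl /= mxE /=; congr (_ + _).
  congr (_ * _); rewrite /cofactor addn0 expr0 mul1r; congr (\det _).
  by apply/matrixP=> i j; rewrite !mxE.
rewrite -sumrN; apply: eq_bigr => j _; rewrite mxE /= -mulrN; congr (_ * _).
have szr : size (retarget L j x) = size L by rewrite size_set_nth; apply/maxn_idPr; case: j.
rewrite /dlist szr /cofactor; case: (size L) j szr => [[]//|n] j szr.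
rewrite add0n lift0 exprS mulN1r mulNr; congr (- _).
(* Both determinants are expanded along the column carrying [x]: column 0 of the minor, column [j]
   of the retargeted matrix. *)
rewrite (expand_det_col _ ord0) (expand_det_col (dmx _ _ _) j) mulr_sumr.
apply: eq_bigr => i _; rewrite !mxE /retarget !nth_set_nth /= eqxx /=.
rewrite mulrCA; congr (K _ _ * _).
  by case: eqP => // ->.
rewrite /cofactor mulrA addn0 -exprD addnC; congr (_ * \det _).
apply/matrixP=> p q; rewrite !mxE !nth_set_nth /= (eq_sym (bump j q)) (negPf (neq_bump _ _)).
congr (K _ _); first by case: eqP => // ->.
by have -> : bump (bump 0 j) (bump 0 q) = (bump j q).+1 by rewrite /bump; lia.
Qed.

Lemma retarget_zip A xs F j x : size A = size xs -> (j < size xs)%N ->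
  retarget (zip A xs ++ F) j x = zip A (set_nth 0%N xs j x) ++ F.
Proof.
rewrite /retarget; elim: A xs j => [|a A IH] [|y xs] [|j] //= [szA] ltj.
by rewrite IH.
Qed.

(** Agreement for all good ends survives the opening of a strand at [w]: by [dlist_cramer] the
    larger determinants are combinations, with equal coefficients, of smaller ones whose open ends
    are again good. *)
Lemma dlist_ext (good : pred nat) K1 K2 F1 F2 A1 A2 w : size A1 = size A2 ->
  (forall xs, size xs = size A1 -> all good xs ->
     dlist K1 (zip A1 xs ++ F1) = dlist K2 (zip A2 xs ++ F2)) ->
  (forall x, good x -> K1 w x = K2 w x) ->
  (forall c, c \in F1 -> K1 w c.2 = 0) -> (forall c, c \in F2 -> K2 w c.2 = 0) ->
  forall x xs, size xs = size A1 -> good x -> all good xs ->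
  dlist K1 ((w, x) :: zip A1 xs ++ F1) = dlist K2 ((w, x) :: zip A2 xs ++ F2).
Proof.
move=> szA IH Kw z1 z2 x xs szx gx gxs.
rewrite !dlist_cramer Kw // IH //; congr (_ - _).
(* Finished strands contribute nothing to the expansion, as row [w] vanishes at their ends. *)
have red K A F : size A = size A1 -> (forall c, c \in F -> K w c.2 = 0) ->
   \sum_(j < size (zip A xs ++ F)) K w (nth (0%N, 0%N) (zip A xs ++ F) j).2 *
      dlist K (retarget (zip A xs ++ F) j x) =
   \sum_(0 <= j < size xs) K w (nth 0%N xs j) * dlist K (zip A (set_nth 0%N xs j x) ++ F).
  move=> szA' zF.
  rewrite -(big_mkord xpredT (fun j => K w (nth (0%N, 0%N) (zip A xs ++ F) j).2 *
      dlist K (retarget (zip A xs ++ F) j x))).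
  have szz : size (zip A xs) = size xs by rewrite size_zip szA' szx minnn.
  rewrite size_cat szz (big_cat_nat (leq0n _) (leq_addr _ _)) /=.
  rewrite [X in _ + X]big_nat_cond [X in _ + X]big1 ?addr0; last first.
    move=> j; rewrite andbT => /andP[le_j lt_j]; rewrite nth_cat szz ltnNge le_j /=.
    by rewrite zF ?mul0r // mem_nth // ltn_subLR.
  rewrite big_nat_cond [RHS]big_nat_cond; apply: eq_bigr => j; rewrite andbT => /andP[_ lt_j].
  rewrite retarget_zip ?szA' //; congr (K w _ * _).
  by rewrite nth_cat szz lt_j nth_zip ?szA'.
rewrite !red -?szA // big_nat_cond [RHS]big_nat_cond; apply: eq_bigr => j; rewrite andbT => /andP[_ lt_j].
have gs : all good (set_nth 0%N xs j x).
  apply/(all_nthP 0%N) => i; rewrite size_set_nth (maxn_idPr lt_j) => lti.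
  by rewrite nth_set_nth /=; case: eqP => // _; apply: (all_nthP 0%N gxs).
rewrite IH // ?Kw //; first exact: (all_nthP 0%N gxs).
by rewrite size_set_nth (maxn_idPr lt_j).
Qed.

End Dlist.

(** * Ribbon determinants and the exchange step at a turn *)

Lemma dlist_scale_row (R : comNzRingType) (e : nat -> R) K L :
  dlist (fun p x => e p * K p x) L = (\prod_(c <- L) e c.1) * dlist K L.
Proof. by rewrite dlist_tr (dlist_scale e (fun x p => K p x)) big_map -dlist_tr. Qed.

Lemma iota_rcons v : iota 0 v.+1 = rcons (iota 0 v) v.
Proof. by rewrite -addn1 iotaD cats1. Qed.

Section Sweep.
Variables (R : comNzRingType) (E : nat -> nat -> R) (U : pred nat).
Hypothesis E1 : forall p, E p p = 1.
Hypothesis E0 : forall p q, (q < p)%N -> E p q = 0.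

Definition breaks v p x := [seq u <- iota 0 v.+1 | [&& (p < u)%N, (u < x)%N & U u]].

(* The Jacobi-Trudi determinant of a ribbon whose horizontal steps are at the
   vertices of U in ]p, x[, except that those beyond v are ignored. *)
Definition rk v p x := dlist E (zip (p :: breaks v p x) (rcons (breaks v p x) x)).

Lemma rk_nobreak v p x :
  (forall u, (u <= v)%N -> (p < u < x)%N -> ~~ U u) -> rk v p x = E p x.
Proof.
move=> noU; rewrite /rk; suff ->: breaks v p x = [::] by rewrite dlist1.
rewrite /breaks (@eq_in_filter _ _ pred0) ?filter_pred0 // => u.
rewrite mem_iota /= => ltu; apply/negbTE/and3P=> -[pu ux]; apply/negP/noU; lia.
Qed.

Lemma rk_skip v p x : ~~ [&& (p < v.+1)%N, (v.+1 < x)%N & U v.+1] ->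
  rk v.+1 p x = rk v p x.
Proof.
move=> noU; rewrite /rk; suff ->: breaks v.+1 p x = breaks v p x by [].
by rewrite /breaks iota_rcons filter_rcons (negPf noU).
Qed.

(** Expansion along the row of the new break [w]. By [E0] this row vanishes at all earlier ends, so
    only the columns of [w] and [x] survive. *)
Lemma rk_step v p x : (p < v.+1 < x)%N -> U v.+1 ->
  rk v.+1 p x = rk v p v.+1 * E v.+1 x - rk v p x.
Proof.
set w := v.+1 => /andP[pw wx] Uw.
have brw : breaks w p x = rcons (breaks v p x) w.
  by rewrite /breaks iota_rcons filter_rcons -/w pw wx Uw.
have brv : breaks v p w = breaks v p x.
  by apply: eq_in_filter=> u; rewrite mem_iota => ltu; congr [&& _, _ & _]; lia.
have ltl u : u \in breaks v p x -> (u < w)%N.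
  by rewrite mem_filter mem_iota => /andP[_]; lia.
rewrite /rk brw brv -rcons_cons zip_rcons /= ?size_rcons // -cats1 -/(zip (p :: _) _).
set l := breaks v p x in ltl *.
rewrite (@dlist_perm _ _ _ ((w, x) :: zip (p :: l) (rcons l w))); last first.
  by rewrite -cat1s perm_catC.
have szl : size (zip (p :: l) (rcons l w)) = (size l).+1.
  by rewrite size_zip size_rcons minnn.
rewrite dlist_cramer szl big_ord_recr big1 /= => [|j _].
  rewrite add0r mulrC; congr (_ - _).
  rewrite (@nth_zip _ _ 0%N 0%N (p :: l)) ?size_rcons //= nth_rcons ltnn eqxx E1 mul1r.
  rewrite -[zip _ _]cats0 retarget_zip ?size_rcons // cats0.
  congr (dlist _ (zip _ _)).
  by elim: (l) => //= y l' ->.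
rewrite (@nth_zip _ _ 0%N 0%N (p :: l)) ?size_rcons //= nth_rcons ltn_ord.
by rewrite E0 ?mul0r // ltl // mem_nth.
Qed.

Lemma rk_from v p x : (v <= p)%N -> rk v p x = E p x.
Proof.
move=> vp; apply: rk_nobreak => u uv /andP[pu _].
by move: (leq_trans (leq_trans pu uv) vp); rewrite ltnn.
Qed.

Section Step.
Variable v : nat.
Let w := v.+1.
Let K := rk v.
Let K' := rk w.
(** The sign with which [K p x] enters [K' p x]: by [rk_step] it is negative exactly for ends beyond
    [w]. Over the open strands these signs multiply to the sign of the rotation, see [prod_e]. *)
Let e x : R := if (w < x)%N then -1 else 1.

Variables (F : seq (nat * nat)).
Hypothesis Fv : all (fun c => (c.1 <= v) && (c.2 <= v))%N F.

Let Kw x : K w x = E w x. Proof. exact: rk_from. Qed.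
Let K'w x : K' w x = E w x. Proof. exact: rk_from. Qed.
Let K'le p q : (q <= w)%N -> K' p q = K p q.
Proof. by move=> qw; apply: rk_skip; rewrite -/w [(w < q)%N]ltnNge qw andbF. Qed.

Lemma prod_e A xs : size A = size xs -> all (fun x => w < x)%N xs ->
  \prod_(c <- zip A xs ++ F) e c.2 = (-1) ^+ size xs.
Proof.
move=> szA gxs; rewrite big_cat /= [X in _ * X]big_seq [X in _ * X]big1 => [|c cF]; last first.
  have /andP[_ cv] := allP Fv _ cF; by rewrite /e ltnNge (leq_trans cv (leqnSn v)).
rewrite mulr1; elim: xs A szA gxs => [|x xs IH] [|a A] //=; first by rewrite big_nil.
by move=> [szA] /andP[wx gxs]; rewrite big_cons IH //= /e wx exprS.
Qed.

Lemma mem_zip_cat A xs p x : all (fun a => a <= v)%N A -> all (fun x => w < x)%N xs ->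
  p \in map fst (zip A xs ++ F) -> x \in map snd (zip A xs ++ F) ->
  (p <= v)%N /\ ((w < x) || (x <= v))%N.
Proof.
move=> Av gxs; rewrite !map_cat !mem_cat => pin xin; split.
  case/orP: pin => [pA|/mapP[c cF ->]]; last by case/andP: (allP Fv _ cF).
  apply: (allP Av); elim: (A) (xs) pA => [|a A' IH] [|y ys] //=.
  by rewrite !inE => /orP[->//|/IH ->]; rewrite orbT.
case/orP: xin => [xX|/mapP[c cF ->]]; last by case/andP: (allP Fv _ cF) => _ ->; rewrite orbT.
suff xin : x \in xs by rewrite (allP gxs _ xin).
elim: (A) (xs) xX => [|a A' IH] [|y ys] //=.
by rewrite !inE => /orP[->//|/IH ->]; rewrite orbT.
Qed.

Hypothesis Uw : U w.

Let K'gt p x : (p <= v)%N -> (w < x)%N -> K' p x = K p w * E w x - K p x.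
Proof. by move=> pv wx; apply: rk_step => //; rewrite ltnS pv. Qed.

(** A column ends and another starts at [w], while the ribbons pass through. Rotating the end [w] to
    the start [w] gives a unit pivot, whose Schur complement is [K'] up to the signs [e]. *)
Lemma sweep_turn A xs : all (fun a => a <= v)%N A -> all (fun x => w < x)%N xs ->
  size A = size xs ->
  dlist K (zip (rcons A w) (w :: xs) ++ F) = dlist K' (zip A xs ++ F).
Proof.
move=> Av gxs szA; rewrite dlist_rot_target ?size_rcons ?szA //.
rewrite (@dlist_perm _ _ _ ((w, w) :: zip A xs ++ F)); last first.
  by rewrite zip_rcons // cat_rcons; apply/seq.permP => P; rewrite /= !count_cat /=; lia.
rewrite dlist_pivot ?Kw // -(prod_e szA) // -dlist_scale.
apply: eq_dlist => p x pin xin.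
have [pv /orP[wx|xv]] := mem_zip_cat Av gxs pin xin.
  by rewrite /e wx K'gt // Kw; ring.
by rewrite /e ltnNge (leq_trans xv (leqnSn v)) K'le ?(leq_trans xv) // Kw E0 ?ltnS //=; ring.
Qed.

(** The reverse situation: the columns pass through, the lowest ribbon ends at [w] and a new one
    starts on top. The pivot is now taken on the side of [K']. *)
Lemma sweep_return A b xs : all (fun a => a <= v)%N (rcons A b) -> all (fun x => w < x)%N xs ->
  (size A).+1 = size xs ->
  dlist K (zip (rcons A b) xs ++ F) = dlist K' (zip (w :: A) xs ++ (b, w) :: F).
Proof.
move=> Av gxs szA.
rewrite (@dlist_perm _ _ (zip (w :: A) xs ++ (b, w) :: F)
   (zip (w :: rcons A b) (rcons xs w) ++ F)); last first.
  by rewrite -rcons_cons zip_rcons /= // cat_rcons.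
rewrite dlist_rot_source ?size_rcons ?szA //.
rewrite (@dlist_perm _ _ (zip (rcons (rcons A b) w) _ ++ _) ((w, w) :: zip (rcons A b) xs ++ F)); last first.
  rewrite (@zip_rcons _ _ (rcons A b)) ?size_rcons //.
  by rewrite cat_rcons; apply/seq.permP => P; rewrite /= !count_cat /=; lia.
rewrite dlist_pivot ?K'w // -(@prod_e (rcons A b) xs) ?size_rcons // -dlist_scale.
apply: eq_dlist => p x pin xin.
have [pv /orP[wx|xv]] := mem_zip_cat Av gxs pin xin.
  by rewrite /e wx K'gt // K'w K'le //; ring.
by rewrite /e ltnNge (leq_trans xv (leqnSn v)) !K'le ?(leq_trans xv) // Kw E0 ?ltnS //=; ring.
Qed.

(** A column ends at the top and a ribbon at the bottom. Subtracting [E w x] times column [w] from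
    each column [x] beyond [w] turns [K] into [K'] with negated columns. *)
Lemma sweep_close A b xs : all (fun a => a <= v)%N (rcons A b) -> all (fun x => w < x)%N xs ->
  size A = size xs ->
  dlist K (zip (rcons A b) (w :: xs) ++ F) = dlist K' (zip A xs ++ (b, w) :: F).
Proof.
rewrite all_rcons => /andP[bv Av] gxs szA; rewrite dlist_rot_target ?size_rcons ?szA //.
rewrite (@dlist_perm _ _ _ ((b, w) :: zip A xs ++ F)); last first.
  by rewrite zip_rcons // cat_rcons; apply/seq.permP => P; rewrite /= !count_cat /=; lia.
rewrite [RHS](@dlist_perm _ _ _ ((b, w) :: zip A xs ++ F)); last first.
  by apply/seq.permP => P; rewrite /= !count_cat /=; lia.
rewrite -(prod_e szA) //.
pose c x : R := if (w < x)%N then - E w x else 0.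
rewrite -(@dlist_addcol _ c) ?/c ?ltnn //.
have ->: \prod_(c <- zip A xs ++ F) e c.2 = \prod_(c <- (b, w) :: zip A xs ++ F) e c.2.
  by rewrite big_cons /e ltnn mul1r.
rewrite -dlist_scale; apply: eq_dlist => p x /=; rewrite !inE => pin xin.
have pv : (p <= v)%N.
  case/orP: pin => [/eqP->//|pin].
  case: (xs) szA xin pin gxs => [|y ys] szA xin pin gxs.
    case: (A) szA pin => //= _ pin; case/mapP: pin => d dF ->.
    by case/andP: (allP Fv _ dF).
  have yin: y \in [seq i.2 | i <- zip A (y :: ys) ++ F] by case: (A) szA => //= a A' _; rewrite inE eqxx.
  by have [] := mem_zip_cat Av gxs pin yin.
have {xin} [wx|xw] : (w < x)%N \/ (x <= w)%N by lia.
  by rewrite /e wx K'gt //; ring.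
by rewrite /e ltnNge xw K'le //=; ring.
Qed.

(** A column starts at the bottom and a ribbon on top. This time multiples of row [w] are subtracted
    from the other rows. *)
Lemma sweep_open A xs : all (fun a => a <= v)%N A -> all (fun x => w < x)%N xs ->
  (size A).+1 = size xs ->
  dlist K (zip (rcons A w) xs ++ F) = dlist K' (zip (w :: A) xs ++ F).
Proof.
move=> Av; case/lastP: xs => // xs x gxs; rewrite size_rcons => -[szA].
rewrite dlist_rot_source ?size_rcons ?szA //.
rewrite !zip_rcons // cat_rcons.
move: gxs; rewrite all_rcons => /andP[wx gxs].
have pq: perm_eq (zip A xs ++ (w, x) :: F) ((w, x) :: zip A xs ++ F).
  by apply/seq.permP => P; rewrite /= !count_cat /=; lia.
rewrite !(dlist_perm _ pq) -(prod_e szA) //.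
(* Row [w] is the same in [K] and [K'], so the column signs [e] must be undone there; this extra
   sign also accounts for the rotation being one swap shorter than the number of open strands. *)
pose s p : R := if p == w then -1 else 1.
pose a p : R := if p == w then 0 else - K p w.
rewrite -[X in _ = _ * X](@dlist_addrow _ a) ?/a ?eqxx //.
have -> : \prod_(c <- zip A xs ++ F) e c.2 =
   (\prod_(c <- (w, x) :: zip A xs ++ F) e c.2) * (\prod_(c <- (w, x) :: zip A xs ++ F) s c.1).
  rewrite !big_cons /= /e /s wx eqxx mulrACA mulrN1 opprK mul1r.
  rewrite [X in _ * X]big_seq [X in _ * X]big1 ?mulr1 // => c cin.
  case: eqP => // cw; have := @mem_zip_cat A xs c.1 c.2 Av gxs.
  by rewrite !map_f // cw => /(_ isT isT) [] ; rewrite ltnn.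
rewrite -mulrA -dlist_scale_row -dlist_scale.
apply: eq_dlist => p y /=; rewrite !inE => pin yin.
have y_cases : (w < y)%N \/ (y <= v)%N.
  case/orP: yin => [/eqP->|yin]; first by left.
  rewrite map_cat mem_cat in yin; case/orP: yin => [yX|/mapP[c cF ->]].
    left; apply: (allP gxs); elim: (A) (xs) yX => [|a' A' IH] [|y' ys] //=.
    by rewrite !inE => /orP[->//|/IH ->]; rewrite orbT.
  by right; case/andP: (allP Fv _ cF).
have p_cases : p = w \/ (p <= v)%N.
  case/orP: pin => [/eqP->|pin]; first by left.
  rewrite map_cat mem_cat in pin; case/orP: pin => [pA|/mapP[c cF ->]].
    right; apply: (allP Av); elim: (A) (xs) pA => [|a' A' IH] [|y' ys] //=.
    by rewrite !inE => /orP[->//|/IH ->]; rewrite orbT.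
  by right; case/andP: (allP Fv _ cF).
case: p_cases => [->|pv]; rewrite /s.
  rewrite eqxx K'w Kw mul0r addr0; case: y_cases => [wy|yv].
    by rewrite /e wy; ring.
  by rewrite E0 ?ltnS //=; ring.
have -> : (p == w) = false by apply/eqP=> pw; move: pv; rewrite pw ltnn.
rewrite K'w; case: y_cases => [wy|yv].
  by rewrite /e wy K'gt //; ring.
by rewrite /e ltnNge (leq_trans yv (leqnSn v)) K'le ?(leq_trans yv) // E0 ?ltnS //=; ring.
Qed.

End Step.
End Sweep.

(** * Sweeping across the diagonals *)

(* The state of the sweep at a vertex: the (start, end) pairs of the finished
   strands, and the starts of the strands crossing the current diagonal, listed
   from top to bottom. *)
Definition strands := (seq (nat * nat) * seq nat)%type.

(* u: the strands go right at w; t (resp. s): the upper (resp. lower) boundary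
   of the shape goes right at w. *)
Definition mstep (u t s : bool) (w : nat) (S : strands) : strands :=
  if u then (if s then S.1 else (last 0%N S.2, w) :: S.1,
             (if t then [::] else [:: w]) ++ (if s then S.2 else take (size S.2).-1 S.2))
  else (if t then (head 0%N S.2, w) :: S.1 else S.1,
        (if t then behead S.2 else S.2) ++ (if s then [:: w] else [::])).

Definition bounded v (S : strands) :=
  all (fun c => (c.1 <= v) && (c.2 <= v))%N S.1 && all (fun a => a <= v)%N S.2.

Lemma bounded_step v u t s S : (0 < size S.2)%N -> bounded v S ->
  bounded v.+1 (mstep u t s v.+1 S).
Proof.
case: S => F A /= A0 /andP[/= Fv Av].
have Fw : all (fun c => (c.1 <= v.+1) && (c.2 <= v.+1))%N F.
  by apply: sub_all Fv => c /andP[? ?]; lia.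
have Aw : all (fun a => a <= v.+1)%N A by apply: sub_all Av => c ?; lia.
have Tw : all (fun a => a <= v.+1)%N (take (size A).-1 A).
  by apply/allP => x /mem_take; apply: (allP Aw).
have hd : (head 0 A <= v.+1)%N by case: (A) Aw => //= ? ? /andP[].
have Bw : all (fun a => a <= v.+1)%N (behead A) by case: (A) Aw => //= ? ? /andP[].
have la : (last 0 A <= v.+1)%N.
  by case: (A) Aw A0 => // a A' Aw _; rewrite /= (allP Aw) ?mem_last.
by rewrite /bounded /mstep; case: u t s => [] [] [] /=;
  rewrite ?all_cat /= ?Fw ?Aw ?Tw ?Bw ?hd ?la ?leqnn.
Qed.

(** The change does not involve [u]: the number of crossing strands is governed by the boundary, so
    columns and ribbons stay equinumerous. *)
Lemma size_step u t s w S : (0 < size S.2)%N ->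
  size (mstep u t s w S).2 = (size S.2 + s - t)%N.
Proof.
case: S => F [|a A] //= _; rewrite /mstep; case: u t s => [] [] [] /=;
 rewrite ?size_cat ?size_take /= ?leqnn ?ltnS ?leqnn; lia.
Qed.

Section Machine.
Variables (R : comNzRingType) (E : nat -> nat -> R) (U : pred nat).
Hypothesis E1 : forall p, E p p = 1.
Hypothesis E0 : forall p q, (q < p)%N -> E p q = 0.

(** Columns have no horizontal steps, so their kernel is [E] itself. The ends [xs] of the open
    strands are arbitrary beyond [v], which lets later steps choose them. *)
Definition agree v (C S : strands) : Prop :=
  [/\ size C.2 = size S.2, bounded v C, bounded v S &
      forall xs, size xs = size C.2 -> all (fun x => v < x)%N xs ->
        dlist E (zip C.2 xs ++ C.1) = dlist (rk E U v) (zip S.2 xs ++ S.1)].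

(** Both kernels have the same row at the new start [v.+1], and this row vanishes at all finished
    ends, so [dlist_ext] applies. *)
Lemma agree_ext v C S ys : agree v C S -> size ys = (size C.2).+1 ->
  all (fun x => v < x)%N ys ->
  dlist E (zip (rcons C.2 v.+1) ys ++ C.1) =
  dlist (rk E U v) (zip (rcons S.2 v.+1) ys ++ S.1).
Proof.
case=> szCS /andP[/allP FC _] /andP[/allP FS _] IH.
case/lastP: ys => // ys y; rewrite size_rcons all_rcons => -[szy] /andP[vy vys].
rewrite !zip_rcons -?szCS // !cat_rcons.
have pq (A F : strands) : perm_eq (zip A.2 ys ++ (v.+1, y) :: A.1) ((v.+1, y) :: zip A.2 ys ++ A.1).
  by apply/seq.permP => P; rewrite /= !count_cat /=; lia.
rewrite !(dlist_perm _ (pq _ ([::], [::]))).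
apply: (@dlist_ext _ (fun x => v < x)%N) => //.
- by move=> x _; rewrite rk_from.
- by move=> c /FC /andP[_ ?]; rewrite E0.
- by move=> c /FS /andP[_ ?]; rewrite rk_from ?E0.
Qed.

Lemma agree_step v C S t s : agree v C S -> (0 < size C.2)%N ->
  agree v.+1 (mstep false t s v.+1 C) (mstep (U v.+1) t s v.+1 S).
Proof.
move=> agr C0; have ext := agree_ext agr; case: agr => szCS bC bS IH.
have S0 : (0 < size S.2)%N by rewrite -szCS.
split; rewrite ?size_step ?szCS ?bounded_step //.
set w := v.+1; move=> xs szx gxs.
have gxs' : all (fun x => v < x)%N xs by apply: sub_all gxs => x ?; lia.
(* The invariant is first used with the old kernel: a closing top column receives the end [w], and a
   column opening at the bottom is handled by [agree_ext]. *)
have -> : dlist E (zip (mstep false t s w C).2 xs ++ (mstep false t s w C).1) =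
   dlist (rk E U v) (zip ((if s then rcons S.2 w else S.2)) (if t then w :: xs else xs) ++ S.1).
  have -> : dlist E (zip (mstep false t s w C).2 xs ++ (mstep false t s w C).1) =
       dlist E (zip ((if s then rcons C.2 w else C.2)) (if t then w :: xs else xs) ++ C.1).
    apply: dlist_perm; apply/seq.permP => P; case: (C) C0 => F [|a A] // _.
    rewrite /mstep !count_cat; case: t s {szx} => [] [] /=; rewrite ?cats1 ?cats0 //; lia.
  case: s szx => szx.
    by apply: ext; case: t szx => /= szx; rewrite ?szx ?szCS /= ?ltnS ?leqnn //; lia.
  by apply: IH; case: t szx => /= szx; rewrite ?szx ?szCS /= ?ltnS ?leqnn //; lia.
have [FS AS] := andP bS.
(* Without a horizontal step at [w] the kernel does not change and the ribbons make the same moves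
   as the columns. *)
have [Uw|nUw] := boolP (U w); last first.
  apply/esym; transitivity (dlist (rk E U v) (zip (mstep false t s w S).2 xs ++ (mstep false t s w S).1)).
    by apply: eq_dlist => p x _ _; apply: rk_skip; rewrite (negPf nUw) !andbF.
  apply: dlist_perm; apply/seq.permP => P; case: (S) S0 => F [|a A] // _.
  rewrite /mstep !count_cat; case: t s {szx} => [] [] /=; rewrite ?cats1 ?cats0 //; lia.
case: S szCS S0 FS AS szx {bS IH ext} => F A /= szCS S0 FS AS.
case/lastP: A szCS S0 AS => // A b szCS _ AS.
have tk : take (size A) (rcons A b) = A by rewrite -cats1 take_size_cat.
rewrite /mstep last_rcons size_rcons /= tk.
(* The four combinations of boundary directions are the four exchange lemmas. *)
case: t s gxs => [] [] gxs /= szx.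
- by rewrite sweep_turn // size_rcons; lia.
- by rewrite -sweep_close //; lia.
- by rewrite -sweep_open // size_rcons; lia.
- by rewrite -sweep_return //; lia.
Qed.

Lemma agree_start k : agree k ([::], [:: k]) ([::], [:: k]).
Proof.
split; rewrite /bounded /= ?leqnn // => -[|x []] //= _ _.
by rewrite !dlist1 /= rk_from.
Qed.

(** The single remaining strand gets the end [k.+1]; no end lies beyond [k.+1], so [rk] may be taken
    at [k.+1] as well. *)
Lemma agree_end k C S : agree k C S -> size C.2 = 1%N ->
  dlist E ((head 0%N C.2, k.+1) :: C.1) = dlist (rk E U k.+1) ((head 0%N S.2, k.+1) :: S.1).
Proof.
case=> szCS bC bS /(_ [:: k.+1]) IH sz1.
transitivity (dlist (rk E U k) ((head 0%N S.2, k.+1) :: S.1)).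
  move: IH; case: (C) (S) sz1 szCS => F [|a []] // [F' [|a' []]] //= _ _ -> //=.
  by rewrite leqnn.
apply: eq_dlist => p x _ /=; rewrite inE => xin; apply/esym/rk_skip.
suff : (x <= k.+1)%N by rewrite [(k.+1 < x)%N]ltnNge => ->; rewrite andbF.
case/orP: xin => [/eqP->//|/mapP[c cS ->]].
by case/andP: bS => /allP /(_ _ cS) /andP[_ ?] _; lia.
Qed.

End Machine.

(** * Connected skew shapes by diagonals *)

(* A connected skew shape in diagonal coordinates: the k-th diagonal occupies
   the rows from top k to bot k. *)
Record dshape := DShape { kmin : nat; kmax : nat; top : nat -> nat; bot : nat -> nat }.

Definition dcell (D : dshape) k i :=
  [&& kmin D <= k, k <= kmax D, top D k <= i & i <= bot D k]%N.

(** The two boundaries are lattice paths: from one diagonal to the next the row is kept by a right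
    step and drops by one at an up step. They meet on the first and on the last diagonal. *)
Definition dshape_ok (D : dshape) :=
  [/\ (kmin D <= kmax D)%N,
      forall k, (kmin D <= k <= kmax D)%N -> (0 < top D k <= bot D k)%N,
      forall k, (kmin D <= k < kmax D)%N ->
        (top D k.+1 <= top D k <= (top D k.+1).+1)%N /\
        (bot D k.+1 <= bot D k <= (bot D k.+1).+1)%N,
      top D (kmin D) = bot D (kmin D) & top D (kmax D) = bot D (kmax D)].

(** * Strands through a shape for a given set of horizontal steps *)

Section Strands.
Variables (D : dshape) (U : pred nat).
Hypothesis okD : dshape_ok D.

(** Vertex [k.+1] separates the diagonals [k] and [k.+1]; [U] at this vertex decides the direction
    in which cells of diagonal [k] are left. *)
Definition dnext k i := if U k.+1 then i else i.-1.

(* The diagonal on which the strand through the cell (k, i) starts. *)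
Fixpoint dstart k i :=
  if k is k'.+1 then
    let i' := if U k then i else i.+1 in
    if dcell D k' i' then dstart k' i' else k
  else 0%N.

Definition drows k := iota (top D k) (bot D k - top D k).+1.

Definition dends_on k := [seq i <- drows k | ~~ dcell D k.+1 (dnext k i)].

Fixpoint dends m : seq (nat * nat) :=
  if m is m'.+1 then [seq (kmin D + m', i)%N | i <- dends_on (kmin D + m')] ++ dends m' else [::].

(** The end is one more than the last diagonal, so that end minus start is the number of cells. *)
Definition dpair (c : nat * nat) := (dstart c.1 c.2, c.1.+1).

Definition dstate m : strands :=
  ([seq dpair c | c <- dends m], [seq dstart (kmin D + m) i | i <- drows (kmin D + m)]).

Lemma mem_drows k i : (kmin D <= k <= kmax D)%N -> (i \in drows k) = dcell D k i.
Proof.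
move=> kr; have [_ /(_ k kr) /andP[_ tb] _ _ _] := okD.
by rewrite mem_iota /dcell; lia.
Qed.

Lemma filter_iota1 (a n j : nat) (P : pred nat) : (a <= j < a + n)%N ->
  (forall i, (a <= i < a + n)%N -> P i = (i == j)) -> [seq i <- iota a n | P i] = [:: j].
Proof.
move=> jr Pj; rewrite (@eq_in_filter _ _ (pred1 j)); last first.
  by move=> i; rewrite mem_iota /= => ir; rewrite Pj.
by rewrite filter_pred1_uniq ?iota_uniq ?mem_iota.
Qed.

(** On a right move only the bottom cell can leave the shape, on an up move only the top cell. *)
Lemma dends_onE k : (kmin D <= k < kmax D)%N ->
  dends_on k = if U k.+1 then (if bot D k.+1 == bot D k then [::] else [:: bot D k])
               else (if top D k.+1 == top D k then [:: top D k] else [::]).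
Proof.
move=> kr; have [_ tb st _ _] := okD.
have := st k kr; have := tb k; have := tb k.+1.
move=> /(_ ltac:(lia)) tb1 /(_ ltac:(lia)) tb0 [st1 st2].
rewrite /dends_on /drows /dnext /dcell; case: ifP => Uk.
  case: eqP => e; last by apply: filter_iota1 => [|i ir]; lia.
  rewrite (@eq_in_filter _ _ pred0) ?filter_pred0 // => i; rewrite mem_iota => ir /=.
  by apply/negbTE/negPn; lia.
case: eqP => e; first by apply: filter_iota1 => [|i ir]; lia.
rewrite (@eq_in_filter _ _ pred0) ?filter_pred0 // => i; rewrite mem_iota => ir /=.
by apply/negbTE/negPn; lia.
Qed.

(** The geometry follows the abstract machine: right moves keep the rows of a diagonal and up moves
    shift them by one, so strands appear or disappear only at the two extremities of the row
    interval. *)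
Lemma dstate_step m : (kmin D + m < kmax D)%N ->
  dstate m.+1 = mstep (U (kmin D + m).+1) (top D (kmin D + m).+1 == top D (kmin D + m))
    (bot D (kmin D + m).+1 == bot D (kmin D + m)) (kmin D + m).+1 (dstate m).
Proof.
rewrite /dstate [dends m.+1]/= addnS; set k := (kmin D + m)%N => kr.
have kr' : (kmin D <= k < kmax D)%N by rewrite leq_addr.
have [_ tb st _ _] := okD.
have := st k kr'; have := tb k; have := tb k.+1.
move=> /(_ ltac:(lia)) tb1 /(_ ltac:(lia)) tb0 [st1 st2].
rewrite dends_onE // /mstep /drows; cbn [fst snd].
have dsE i : dstart k.+1 i =
   let i' := if U k.+1 then i else i.+1 in if dcell D k i' then dstart k i' else k.+1 by [].
have iS a n : iota a n.+1 = a :: iota a.+1 n by [].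
have bh (f : nat -> nat) a n : behead [seq f i | i <- iota a n.+1] = [seq f i | i <- iota a.+1 n] by [].
have szm (f : nat -> nat) a n : size [seq f i | i <- iota a n] = n by rewrite size_map size_iota.
case: ifP dsE => Uk dsE.
  congr pair.
    have lastE : last 0%N [seq dstart k i | i <- iota (top D k) (bot D k - top D k).+1] = dstart k (bot D k).
      rewrite -[(bot D k - top D k).+1]addn1 iotaD cats1 map_rcons last_rcons subnKC //; lia.
    by rewrite lastE; case: eqP.
  rewrite szm -map_take take_iota.
  have E a n : (top D k <= a)%N -> (a + n <= (bot D k).+1)%N ->
      [seq dstart k.+1 i | i <- iota a n] = [seq dstart k i | i <- iota a n].
    move=> ta an; apply/eq_in_map => i; rewrite mem_iota => ir; rewrite dsE /=.
    by have -> : dcell D k i by rewrite /dcell; lia.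
  have Ef : (top D k.+1 < top D k)%N -> dstart k.+1 (top D k.+1) = k.+1.
    by move=> lt; rewrite dsE /= /dcell [(top D k <= top D k.+1)%N]leqNgt lt !andbF.
  case: eqP => et; case: eqP => eb.
  - by rewrite et eb E //; lia.
  - by rewrite et E ?cat0s; [congr (map _ (iota _ _)); lia|lia|lia].
  - have -> : (bot D k.+1 - top D k.+1).+1 = (bot D k - top D k).+2 by lia.
    rewrite iS map_cons Ef; last by lia.
    by rewrite (_ : (top D k.+1).+1 = top D k) ?E //=; lia.
  - have -> : (bot D k.+1 - top D k.+1).+1 = (minn (bot D k - top D k).+1.-1 (bot D k - top D k).+1).+1 by lia.
    rewrite iS map_cons Ef; last by lia.
    by rewrite (_ : (top D k.+1).+1 = top D k) ?E //=; lia.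
congr pair; first by case: eqP => e //.
have E a n : (top D k <= a.+1)%N -> (a + n <= bot D k)%N ->
    [seq dstart k.+1 i | i <- iota a n] = [seq dstart k i | i <- iota a.+1 n].
  move=> ta an; rewrite (iotaDl 1) -map_comp; apply/eq_in_map => i; rewrite mem_iota => ir; rewrite dsE /=.
  by have -> : dcell D k i.+1 by rewrite /dcell; lia.
have Ef : dstart k.+1 (bot D k) = k.+1.
  by rewrite dsE /= /dcell ltnn !andbF.
have Er a n : (a + n = bot D k)%N -> (top D k <= a.+1)%N ->
    [seq dstart k.+1 i | i <- iota a n.+1] = [seq dstart k i | i <- iota a.+1 n] ++ [:: k.+1].
  by move=> an ta; rewrite -[n.+1]addn1 iotaD map_cat an [iota _ 1]/= map_cons Ef E ?an.
case: eqP => et; case: eqP => eb.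
- by rewrite et eb bh Er //; lia.
- by rewrite et cats0 bh E; [congr (map _ (iota _ _)); lia|lia|lia].
- by rewrite Er; [congr (map _ (iota _ _) ++ _); lia|lia|lia].
- by rewrite cats0 E; [congr (map _ (iota _ _)); lia|lia|lia].
Qed.


Lemma mem_dends m k i : (kmin D + m <= (kmax D).+1)%N ->
  ((k, i) \in dends m) = [&& (k < kmin D + m)%N, dcell D k i & ~~ dcell D k.+1 (dnext k i)].
Proof.
elim: m => [|m IH] km /=.
  by rewrite in_nil /dcell addn0; apply/esym/negbTE; rewrite ltnNge; case: (kmin D <= k)%N; rewrite ?andbF.
rewrite mem_cat IH; last by lia.
have -> : ((k, i) \in [seq ((kmin D + m)%N, i0) | i0 <- dends_on (kmin D + m)]) =
    (k == kmin D + m)%N && (i \in dends_on k).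
  apply/mapP/andP => [[j jin [-> ->]]|[/eqP-> iin]]; first by rewrite eqxx.
  by exists i.
rewrite addnS ltnS (leq_eqVlt k) andb_orl; congr (_ || _).
case: eqP => //= ->; rewrite mem_filter andbC mem_drows //; lia.
Qed.

Lemma dends_uniq m : uniq (dends m).
Proof.
elim: m => //= m IH; rewrite cat_uniq IH map_inj_uniq => [|i j [] //].
rewrite filter_uniq ?iota_uniq //= andbT; apply/hasPn => -[k i] kin; apply/mapP=> -[j _ [kE _]].
suff: (k < kmin D + m)%N by rewrite kE ltnn.
elim: (m) kin => //= m' IHm; rewrite mem_cat => /orP[/mapP[? _ [-> _]]|/IHm]; lia.
Qed.

Definition dpairs := [seq dpair c | c <- dends (kmax D - kmin D).+1].

(** A family is identified with the strands through its tails: they must be exactly the cells where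
    strands leave the shape, and each head must be where the strand began. This serves for columns
    and ribbons alike. *)
Lemma perm_dpairs (T : eqType) (X : seq T) (hd : T -> nat) (tl : T -> nat * nat) :
  uniq (map tl X) ->
  (forall c, (c \in map tl X) = dcell D c.1 c.2 && ~~ dcell D c.1.+1 (dnext c.1 c.2)) ->
  {in X, forall x, hd x = dstart (tl x).1 (tl x).2} ->
  perm_eq [seq (hd x, (tl x).1.+1) | x <- X] dpairs.
Proof.
move=> uX memX hdX; have [kk _ _ _ _] := okD.
have -> : [seq (hd x, (tl x).1.+1) | x <- X] = [seq dpair c | c <- map tl X].
  by rewrite -map_comp; apply/eq_in_map => x /hdX hdx; rewrite /= /dpair -hdx.
apply/perm_map/uniq_perm => //; first exact: dends_uniq.
case=> k i; rewrite memX mem_dends /=; last by lia.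
case: (boolP (dcell D k i)) => [/and4P[? ? _ _]|]; last by rewrite andbF.
by have -> : (k < kmin D + (kmax D - kmin D).+1)%N by lia.
Qed.

End Strands.

(** With [pred0] all strands go up, so the left side belongs to the columns. *)
Lemma sweep_dshape (R : comNzRingType) (E : nat -> nat -> R) D U : dshape_ok D ->
  (forall p, E p p = 1) -> (forall p q, (q < p)%N -> E p q = 0) ->
  dlist E (dpairs D pred0) = dlist (rk E U (kmax D).+1) (dpairs D U).
Proof.
move=> okD E1 E0; have [kk tb st tmin tmax] := okD.
have szst V m : (kmin D + m <= kmax D)%N -> (0 < size (dstate D V m).2)%N by rewrite size_map size_iota.
have agr m : (kmin D + m <= kmax D)%N ->
    agree E U (kmin D + m) (dstate D pred0 m) (dstate D U m).
  elim: m => [_|m IH km].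
    have rows V : dstate D V 0 = ([::], [:: kmin D]).
      rewrite /dstate /drows addn0 tmin subnn /= ; congr (_, [:: _]).
      by case kE: (kmin D) => [|k] //=; rewrite /dcell kE ltnn.
    by rewrite !rows addn0; apply: agree_start.
  rewrite !dstate_step ?addnS //; [|lia..].
  by apply: agree_step => //; apply: IH; lia.
have km : (kmin D + (kmax D - kmin D) = kmax D)%N by lia.
have := agr (kmax D - kmin D)%N; rewrite km leqnn => /(_ isT) agrE.
(* The last diagonal is a single cell, so one strand remains to be closed whatever the directions
   are. *)
have en V : dends_on D V (kmax D) = [:: top D (kmax D)].
  by rewrite /dends_on /drows tmax subnn /= /dcell /= ltnn andbF.
have dp V : dpairs D V = (head 0%N (dstate D V (kmax D - kmin D)).2, (kmax D).+1)
       :: (dstate D V (kmax D - kmin D)).1.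
  by rewrite /dpairs /= km en.
rewrite !dp; apply: agree_end => //.
by rewrite size_map size_iota km tmax subnn.
Qed.

(** * Skew diagrams and partitions *)

Section SkewDiagonals.
Variables (P : pred cell) (L n : nat).
Hypothesis Pconv : forall c d e, P c -> P d ->
  (c.1 <= e.1 <= d.1)%N -> (c.2 <= e.2 <= d.2)%N -> P e.
Hypothesis Ppos : forall c, P c -> (0 < c.1 <= L)%N && (0 < c.2 <= n)%N.

(** [L] bounds the rows, so the subtraction does not truncate on cells of [P]; truncation in [Q]
    would give column 0, which [Ppos] excludes. *)
Let diag (c : cell) := (c.2 + L - c.1)%N.
Let Q k i := P (i, k + i - L)%N.

Lemma Q_pos k i : Q k i -> (0 < i <= L)%N /\ (L < k + i <= n + L)%N.
Proof. by move=> /Ppos /andP[/= ? ?]; lia. Qed.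

Lemma Q_conv k i k' i' l j : Q k i -> Q k' i' -> (i <= j <= i')%N ->
  (k + i <= l + j <= k' + i')%N -> Q l j.
Proof. by move=> Qi Qi' jr lr; apply: (Pconv Qi Qi') => /=; lia. Qed.

Lemma Q_diag c : P c -> Q (diag c) c.1.
Proof.
move=> Pc; rewrite /Q /diag subnK ?addnK; first by case: c Pc.
by case/andP: (Ppos Pc); lia.
Qed.

(** A discrete intermediate value argument: adjacent cells lie on consecutive diagonals. *)
Lemma path_diag c p k : path adj c p -> all P (c :: p) ->
  (diag c <= k <= diag (last c p))%N -> exists i, Q k i.
Proof.
elim: p c => [|d p IH] c /=.
  move=> _ /andP[Pc _] kr; exists c.1; rewrite (_ : k = diag c); last by lia.
  exact: Q_diag.
case/andP=> cd pth /andP[Pc /andP[Pd Pp]] /andP[ck kl].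
have [ek|nk] := eqVneq (diag c) k; first by exists c.1; rewrite -ek; apply: Q_diag.
apply: (IH d) => //=; first by rewrite Pd.
rewrite kl andbT; move: ck nk cd; rewrite /diag /adj.
have /andP[c1 c2] := Ppos Pc; have /andP[d1 d2] := Ppos Pd.
by move=> ck nk /orP[] /andP[/eqP e1 /orP[]/eqP e2]; lia.
Qed.

Let dtop k := find (Q k) (iota 0 L.+1).
Let dbot k := (L - find (fun d => Q k (L - d)) (iota 0 L.+1))%N.

Lemma dtopP k i : Q k i -> Q k (dtop k) /\ (dtop k <= i)%N.
Proof.
move=> Qi; have [iL _] := Q_pos Qi.
have h : has (Q k) (iota 0 L.+1) by apply/hasP; exists i => //; rewrite mem_iota; lia.
have fl : (dtop k < L.+1)%N by rewrite -(size_iota 0 L.+1) -has_find.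
split; first by have := nth_find 0%N h; rewrite nth_iota.
rewrite leqNgt; apply/negP => lt.
by have := before_find 0%N lt; rewrite nth_iota ?add0n ?Qi //; lia.
Qed.

Lemma dbotP k i : Q k i -> Q k (dbot k) /\ (i <= dbot k)%N.
Proof.
move=> Qi; have [iL _] := Q_pos Qi.
have Qi' : Q k (L - (L - i)) by rewrite subKn; lia.
have h : has (fun d => Q k (L - d)) (iota 0 L.+1).
  by apply/hasP; exists (L - i)%N => //; rewrite mem_iota; lia.
have fl : (find (fun d => Q k (L - d)) (iota 0 L.+1) < L.+1)%N.
  by rewrite -[X in (_ < X)%N](size_iota 0 L.+1) -has_find.
split; first by have := nth_find 0%N h; rewrite nth_iota.
rewrite leqNgt; apply/negP => lt; move: lt; rewrite /dbot => lt.
have lt' : (L - i < find (fun d => Q k (L - d)) (iota 0 L.+1))%N by lia.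
by have := before_find 0%N lt'; rewrite nth_iota ?add0n ?Qi' //; lia.
Qed.

Lemma Q_dtop_dbot k j : Q k j -> forall i, Q k i = (dtop k <= i <= dbot k)%N.
Proof.
move=> Qj i; have [Qt tj] := dtopP Qj; have [Qb bj] := dbotP Qj.
apply/idP/idP => [Qi|ir]; last by apply: (Q_conv Qt Qb) => //; lia.
by have [_ ti] := dtopP Qi; have [_ bi] := dbotP Qi; rewrite ti bi.
Qed.

Lemma skew_dshape : (exists c, P c) -> edge_connected P ->
  exists2 D, dshape_ok D & forall k i, P (i, k + i - L)%N = dcell D k i.
Proof.
move=> [c0 Pc0] conn.
pose N k := has (Q k) (iota 0 L.+1).
have NQ k i : Q k i -> N k.
  move=> Qi; have [iL _] := Q_pos Qi.
  by apply/hasP; exists i => //; rewrite mem_iota; lia.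
have QN k : N k -> exists i, Q k i by case/hasP => i _; exists i.
have exN : exists k, N k by exists (diag c0); apply: NQ (Q_diag Pc0).
have ubN k : N k -> (k <= n + L)%N by case/QN => i /Q_pos [? ?]; lia.
case: (ex_minnP exN) => k0 N0 min0; case: (ex_maxnP exN ubN) => k1 N1 max1.
have k01 : (k0 <= k1)%N by apply: min0.
(* By connectedness a path joins the extreme diagonals, hence meets every diagonal between them. *)
have ne k : (k0 <= k <= k1)%N -> exists i, Q k i.
  move=> kr; have [i0 Q0] := QN _ N0; have [i1 Q1] := QN _ N1.
  have [p [Pp pth lastp]] := conn _ _ Q0 Q1.
  apply: (path_diag pth); first by rewrite /= -/(Q k0 i0) Q0.
  by rewrite lastp /diag /=; have [? ?] := Q_pos Q0; have [? ?] := Q_pos Q1; lia.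
exists (DShape k0 k1 dtop dbot); last first.
  move=> k i; rewrite -/(Q k i) /dcell /=.
  have [kr|kr] := boolP (k0 <= k <= k1)%N.
    by have [j Qj] := ne _ kr; rewrite (Q_dtop_dbot Qj) andbA kr.
  rewrite andbA (negPf kr); apply/negbTE/negP => Qi; move/negP: kr; apply.
  by rewrite min0 ?max1 ?(NQ _ _ Qi).
split=> //=.
- move=> k /ne [j Qj]; have [Qt tj] := dtopP Qj; have [Qb bj] := dbotP Qj.
  by have [? ?] := Q_pos Qt; lia.
(* If one of the four bounds failed, convexity would give a cell beyond the extreme row of one of
   the two diagonals. *)
- move=> k kr; have [j Qj] := ne k ltac:(lia); have [j' Qj'] := ne k.+1 ltac:(lia).
  have [Qt tj] := dtopP Qj; have [Qb bj] := dbotP Qj.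
  have [Qt' tj'] := dtopP Qj'; have [Qb' bj'] := dbotP Qj'.
  split; apply/andP; split; rewrite leqNgt; apply/negP => lt.
  + suff /dtopP[] : Q k.+1 (dtop k) by lia.
    by apply: (Q_conv Qt Qt'); lia.
  + suff /dtopP[] : Q k (dtop k).-1 by lia.
    by apply: (Q_conv Qt' Qt); lia.
  + suff /dbotP[] : Q k (dbot k).+1 by lia.
    by apply: (Q_conv Qb Qb'); lia.
  + suff /dbotP[] : Q k.+1 (dbot k.+1).+1 by lia.
    by apply: (Q_conv Qb' Qb); lia.
(* Were there two cells on the first diagonal, the cell below the upper one would lie on an earlier
   diagonal; on the last diagonal the cell to its right plays this part. *)
- have [j Qj] := QN _ N0.
  have [Qt tj] := dtopP Qj; have [Qb bj] := dbotP Qj.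
  apply/eqP; rewrite eqn_leq (leq_trans tj) //= leqNgt; apply/negP => lt.
  suff /NQ/min0 : Q k0.-1 (dtop k0).+1 by have [? ?] := Q_pos Qt; lia.
  by have [? ?] := Q_pos Qt; have [? ?] := Q_pos Qb; apply: (Q_conv Qt Qb); lia.
- have [j Qj] := QN _ N1.
  have [Qt tj] := dtopP Qj; have [Qb bj] := dbotP Qj.
  apply/eqP; rewrite eqn_leq (leq_trans tj) //= leqNgt; apply/negP => lt.
  suff /NQ/max1 : Q k1.+1 (dtop k1) by lia.
  by apply: (Q_conv Qt Qb); lia.
Qed.

End SkewDiagonals.

Section Partitions.

Lemma partition_sorted lam : is_partition lam -> sorted geq lam.
Proof. by case/andP. Qed.

Lemma part_geq lam i j : sorted geq lam -> (0 < i <= j)%N -> (part lam j <= part lam i)%N.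
Proof.
move=> srt; rewrite /part => ij.
have [jl|] := ltnP j.-1 (size lam); last by move=> jl; rewrite nth_default.
apply: (sorted_leq_nth _ _ 0%N srt) => //; try by rewrite ?inE; lia.
- by move=> a b c /= ab bc; apply: leq_trans bc ab.
- by move=> a /=.
Qed.

Lemma in_skew_pos lam mu c : is_partition lam -> in_skew lam mu c ->
  (0 < c.1 <= size lam)%N && (0 < c.2 <= part lam 1)%N.
Proof.
move=> plam /and4P[r0 c0 cl _]; rewrite /Defs.row /Defs.col in r0 c0 cl.
rewrite r0 c0 (leq_trans cl) ?part_geq ?partition_sorted // andbT /=.
rewrite leqNgt andbT; apply/negP => lt; move: cl; rewrite /part nth_default; lia.
Qed.

Lemma in_skew_conv lam mu c d e : is_partition lam -> is_partition mu ->
  in_skew lam mu c -> in_skew lam mu d ->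
  (c.1 <= e.1 <= d.1)%N -> (c.2 <= e.2 <= d.2)%N -> in_skew lam mu e.
Proof.
move=> pl pm /and4P[r0 c0 cl cm] /and4P[r0' c0' dl dm] r1 r2.
rewrite /Defs.row /Defs.col in r0 c0 cl cm r0' c0' dl dm.
have l1 := @part_geq lam e.1 d.1 (partition_sorted pl); have m1 := @part_geq mu c.1 e.1 (partition_sorted pm).
apply/and4P; rewrite /Defs.row /Defs.col; split; lia.
Qed.

(** The Galois connection between row and column lengths. The induction removes the longest row; if
    that row is shorter than [j], so are all others. *)
Lemma conj_le_geq s j : sorted geq s -> (0 < j)%N ->
  forall i, (0 < i)%N -> (i <= conj s j)%N = (j <= part s i)%N.
Proof.
move=> srt j0; rewrite /conj /part.
elim: s srt => [|x s IH] srt [|i] // _ /=; first by rewrite nth_nil; lia.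
have [jx|xj] := leqP j x.
  case: i => [|i] /=; first by rewrite jx.
  by rewrite add1n ltnS (IH (path_sorted srt) i.+1).
have -> : count (fun x => j <= x)%N s = 0%N.
  apply/eqP; rewrite -leqn0 leqNgt -has_count; apply/hasP => -[y ys jy].
  have := order_path_min _ srt; move=> /(_ ltac:(by move=> a b c /= ab bc; apply: leq_trans bc ab)) /allP /(_ _ ys) /=; lia.
rewrite /= ; case: i => [|i] /=; first by lia.
apply/esym/negbTE; rewrite -ltnNge.
have [il|] := ltnP i (size s); last by move=> ?; rewrite nth_default; lia.
have := order_path_min _ srt; move=> /(_ ltac:(by move=> a b c /= ab bc; apply: leq_trans bc ab)) /allP /(_ _ (mem_nth 0%N il)) /=; lia.
Qed.

Lemma in_skew_conj lam mu i j : is_partition lam -> is_partition mu ->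
  in_skew lam mu (i, j) = [&& 0 < j, conj mu j < i & i <= conj lam j]%N.
Proof.
move=> pl pm; rewrite /in_skew /Defs.row /Defs.col /=.
case: j => [|j]; rewrite ?andbF //=; case: i => [|i]; rewrite ?ltn0 ?andbF //=.
by rewrite [(conj mu _ < _)%N]ltnNge !conj_le_geq ?partition_sorted // andbC.
Qed.

Lemma conj1 lam : is_partition lam -> conj lam 1 = size lam.
Proof. by case/andP=> _; rewrite all_count => /eqP. Qed.

Lemma mem_skew_cells lam mu c : is_partition lam -> (c \in skew_cells lam mu) = in_skew lam mu c.
Proof.
move=> pl; rewrite mem_filter andb_idr // => Pc.
have /andP[c1 c2] := in_skew_pos pl Pc; case: c Pc c1 c2 => i j /= Pc ir jr.
apply/flattenP; exists [seq (i, j) | j <- iota 1 (part lam i)]; apply/mapP.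
  by exists i => //; rewrite mem_iota; lia.
exists j => //; rewrite mem_iota add1n ltnS; case/and4P: Pc; rewrite /Defs.col /Defs.row /=; lia.
Qed.

Lemma contentE lam r c : is_partition lam -> (c.1 <= c.2 + size lam)%N ->
  content lam r c = (c.2 + size lam - c.1)%N%:Z + r - 1.
Proof. move=> pl le; rewrite /content conj1 // /Defs.row /Defs.col; lia. Qed.

End Partitions.

(** * Extremal cells of a list *)

Lemma bestP (better : cell -> cell -> bool) S : (forall x, ~~ better x x) ->
  (forall x y z, better x y -> better y z -> better x z) -> S != [::] ->
  best better S \in S /\ {in S, forall x, ~~ better x (best better S)}.
Proof.
move=> irr tr; rewrite /best; case: S => // c S _.
set f := fun acc x => _.
(* The induction needs that the result never falls behind the accumulator. *)
suff H T acc : let b := foldl f acc T in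
    [/\ b \in acc :: T, b = acc \/ better b acc & {in T, forall x, ~~ better x b}].
  have [bin _ bt] := H (c :: S) c; split=> //.
  by move: bin; rewrite !inE orbA orbb.
elim: T acc => [|x T IH] acc /=; first by rewrite inE eqxx; split=> //; left.
have [bin bb bt] := IH (f acc x); rewrite /f in bin bb bt *.
case: ifP bin bb bt => [xa|nxa] bin bb bt.
  split; first by rewrite inE bin orbT.
    by right; case: bb => [->//|/tr]; apply.
  move=> y; rewrite inE => /orP[/eqP->|/bt //].
  by case: bb => [->//|bx]; apply/negP => /tr /(_ bx); apply/negP.
split=> //; first by move: bin; rewrite !inE => /orP[->//|->]; rewrite !orbT.
move=> y; rewrite inE => /orP[/eqP->|/bt //].
by case: bb => [->//|bx]; [rewrite nxa|apply/negP => /tr /(_ bx); rewrite nxa].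
Qed.

Lemma bottom_leftP S (b := bottom_left S) : S != [::] ->
  b \in S /\ {in S, forall x, (x.1 < b.1)%N || (x.1 == b.1) && (b.2 <= x.2)%N}.
Proof.
pose f (x acc : cell) := (acc.1 < x.1)%N || ((x.1 == acc.1) && (x.2 < acc.2)%N).
have irr x : ~~ f x x by rewrite /f; lia.
have tr x y z : f x y -> f y z -> f x z by rewrite /f; lia.
move=> ne; have [bS bB] := bestP irr tr ne; split=> // x /bB.
by rewrite -/(bottom_left S) -/b /f; lia.
Qed.

Lemma top_rightP S (b := top_right S) : S != [::] ->
  b \in S /\ {in S, forall x, (b.1 < x.1)%N || (x.1 == b.1) && (x.2 <= b.2)%N}.
Proof.
pose f (x acc : cell) := (x.1 < acc.1)%N || ((x.1 == acc.1) && (acc.2 < x.2)%N).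
have irr x : ~~ f x x by rewrite /f; lia.
have tr x y z : f x y -> f y z -> f x z by rewrite /f; lia.
move=> ne; have [bS bB] := bestP irr tr ne; split=> // x /bB.
by rewrite -/(top_right S) -/b /f; lia.
Qed.

(** * Ribbons by diagonals *)

(* Diagonals are numbered by content + L, where L bounds the number of rows, so
   that they are natural numbers. *)
Definition dcell_at L k i : cell := (i, k + i - L)%N.
Definition diag_of L (c : cell) := (c.2 + L - c.1)%N.

Lemma dcell_atK L k i : (L < k + i)%N -> diag_of L (dcell_at L k i) = k.
Proof. by rewrite /diag_of /=; lia. Qed.

Lemma diag_ofK L c : (0 < c.1 <= L)%N -> (0 < c.2)%N -> dcell_at L (diag_of L c) c.1 = c.
Proof. by case: c => i j /= ? ?; rewrite /dcell_at /diag_of /=; congr pair; lia. Qed.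

(** A ribbon meets each diagonal from [p] to [q] in one cell, whose row is [rho]. *)
Record ribbon_rows L (th : seq cell) p q (rho : nat -> nat) : Prop := RibbonRows {
  rr_le : (p <= q)%N;
  rr_mem : forall k i, (dcell_at L k i \in th) = (p <= k <= q)%N && (i == rho k);
  rr_step : forall k, (p <= k < q)%N -> (rho k.+1 <= rho k <= (rho k.+1).+1)%N;
  rr_pos : forall k, (p <= k <= q)%N -> (0 < rho k <= L)%N && (L < k + rho k)%N;
  rr_head : rib_head th = dcell_at L p (rho p);
  rr_tail : rib_tail th = dcell_at L q (rho q) }.

Lemma rho_mono p q (rho : nat -> nat) : (forall k, (p <= k < q)%N -> (rho k.+1 <= rho k)%N) ->
  forall k l, (p <= k <= l)%N -> (l <= q)%N -> (rho l <= rho k)%N.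
Proof.
move=> st k l /andP[pk kl] lq; rewrite -(subnKC kl) in lq *.
elim: (l - k)%N lq => [|d IH] lq; first by rewrite addn0.
rewrite addnS in lq *; apply: leq_trans (IH _); first by apply: st; lia.
lia.
Qed.

(** Two consecutive cells of one diagonal would by convexity span a 2 by 2 block, so every diagonal
    of a ribbon is a single cell. *)
Lemma ribbon_rowsP L n th : (forall c, c \in th -> (0 < c.1 <= L)%N && (0 < c.2 <= n)%N) ->
  is_ribbon th -> exists p q rho, ribbon_rows L th p q rho.
Proof.
move=> pos [ne [lam [mu [pl pm _ thE]]] conn no22].
have conv c d e : c \in th -> d \in th -> (c.1 <= e.1 <= d.1)%N -> (c.2 <= e.2 <= d.2)%N -> e \in th.
  by rewrite !thE; apply: in_skew_conv.
have exc : exists c, c \in th by case: (th) ne => // c ? _; exists c; rewrite inE eqxx.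
have [D [kk tb st _ _] mD] := @skew_dshape (mem th) L n conv pos exc conn.
have posD k i : dcell D k i -> (0 < i <= L)%N && (L < k + i)%N.
  by rewrite -mD => /pos /=; lia.
have tbE k : (kmin D <= k <= kmax D)%N -> bot D k = top D k.
  move=> kr; apply/eqP; have /andP[t0 tb0] := tb _ kr; rewrite eqn_leq tb0 andbT leqNgt.
  apply/negP => lt.
  have Dt : dcell D k (top D k) by rewrite /dcell leqnn tb0 andbA kr.
  have Dt1 : dcell D k (top D k).+1 by rewrite /dcell leqnSn lt !andbT.
  have /andP[? ?] := posD _ _ Dt; have /andP[? ?] := posD _ _ Dt1.
  have T1 : (top D k, k + top D k - L)%N \in th by rewrite -[_ \in _]/(mem th _) mD.
  have T2 : ((top D k).+1, (k + top D k - L).+1)%N \in th.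
    by move: Dt1; rewrite -mD /= addnS subSn //; lia.
  apply: (no22 (top D k) (k + top D k - L)%N); split=> //;
    by apply: (conv _ _ _ T1 T2) => /=; lia.
have mth k i : (dcell_at L k i \in th) = (kmin D <= k <= kmax D)%N && (i == top D k).
  rewrite -[LHS]/(mem th _) mD /dcell andbA; case: (boolP (kmin D <= k <= kmax D)%N) => //= kr.
  by rewrite tbE // eqn_leq andbC.
have tpos k : (kmin D <= k <= kmax D)%N -> (0 < top D k <= L)%N && (L < k + top D k)%N.
  by move=> kr; have /andP[_ tb0] := tb _ kr; apply: posD; rewrite /dcell; lia.
have stp k : (kmin D <= k < kmax D)%N -> (top D k.+1 <= top D k <= (top D k.+1).+1)%N.
  by move=> kr; have [] := st _ kr.
have mono := @rho_mono (kmin D) (kmax D) (top D).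
have {}mono := mono (fun k kr => proj1 (andP (stp k kr))).
have D0 k : (kmin D <= k <= kmax D)%N -> dcell_at L k (top D k) \in th by move=> kr; rewrite mth kr eqxx.
have atK c : c \in th -> let k := diag_of L c in
    [/\ c = dcell_at L k (top D k), (kmin D <= k <= kmax D)%N & (0 < top D k <= L)%N && (L < k + top D k)%N].
  move=> cin k; have /andP[c1 /andP[c2 _]] := pos _ cin.
  have := cin; rewrite -{1}(diag_ofK c1 c2) mth -/k => /andP[kr /eqP cE].
  by split; rewrite ?tpos // -cE /k (diag_ofK c1 c2).
exists (kmin D), (kmax D), (top D); split=> //.
(* Rows weakly decrease along the diagonals, and columns increase within a row; hence the
   bottom-left cell is on the first diagonal and the top-right cell on the last. *)
- have [bin bB] := bottom_leftP ne; have [bE kr kp] := atK _ bin.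
  have := bB _ (D0 (kmin D) ltac:(lia)); rewrite /rib_head bE.
  move: (diag_of L _) kr kp => k kr kp /=; have := mono (kmin D) k; have := tpos (kmin D).
  have [->//|nk] := eqVneq k (kmin D).
  by move=> /(_ ltac:(lia)) t1 /(_ ltac:(lia) ltac:(lia)) t3; lia.
- have [bin bB] := top_rightP ne; have [bE kr kp] := atK _ bin.
  have := bB _ (D0 (kmax D) ltac:(lia)); rewrite /rib_tail bE.
  move: (diag_of L _) kr kp => k kr kp /=; have := mono k (kmax D); have := tpos (kmax D).
  have [->//|nk] := eqVneq k (kmax D).
  by move=> /(_ ltac:(lia)) t1 /(_ ltac:(lia) ltac:(lia)) t3; lia.
Qed.

(** * Outer ribbon decompositions *)

Section Decomposition.
Variables (lam mu : seq nat) (r : int) (Th : seq (seq cell)) (D : dshape).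
Hypotheses (pl : is_partition lam) (pm : is_partition mu).
Hypothesis outer : outer_ribbon_decomposition lam mu Th.
Hypothesis okD : dshape_ok D.
Let L := size lam.
Let at_ := dcell_at L.
Hypothesis inD : forall k i, in_skew lam mu (at_ k i) = dcell D k i.

Lemma dcell_pos k i : dcell D k i -> (0 < i <= L)%N && (L < k + i)%N.
Proof. by rewrite -inD => /(in_skew_pos pl) /=; rewrite -/L; lia. Qed.

Lemma dcell_bounds k i : dcell D k i ->
  [/\ (kmin D <= k)%N, (k <= kmax D)%N, (top D k <= i)%N & (i <= bot D k)%N].
Proof. by move/and4P. Qed.

Lemma dnext_cell k i : dcell D k i -> (k < kmax D)%N -> dcell D k.+1 i || dcell D k.+1 i.-1.
Proof.
have [_ tb st _ _] := okD.
move=> Di lt; have [? ? ? ?] := dcell_bounds Di; have := dcell_pos Di.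
have := st k ltac:(lia); have := tb k.+1 ltac:(lia); rewrite /dcell => ? [? ?] ?; lia.
Qed.

Lemma dcell_between k i : dcell D k i -> dcell D k i.+1 -> (k < kmax D)%N -> dcell D k.+1 i.
Proof.
have [_ tb st _ _] := okD.
move=> Di Di' lt; have [? ? ? ?] := dcell_bounds Di; have [? ? ? ?] := dcell_bounds Di'.
have := st k ltac:(lia); rewrite /dcell => -[? ?]; lia.
Qed.

Lemma at_above k i : dcell D k i -> above (at_ k i) = at_ k.+1 i.-1.
Proof. by move/dcell_pos=> ?; rewrite /above /at_ /dcell_at /=; congr pair; lia. Qed.

Lemma at_right k i : dcell D k i -> rightc (at_ k i) = at_ k.+1 i.
Proof. by move/dcell_pos=> ?; rewrite /rightc /at_ /dcell_at /=; congr pair; lia. Qed.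

Lemma at_below k i : at_ k i.+1 = below (at_ k.+1 i).
Proof. by rewrite /below /at_ /dcell_at /=; congr pair; lia. Qed.

Lemma at_left k i : at_ k i = leftc (at_ k.+1 i).
Proof. by rewrite /leftc /at_ /dcell_at /=; congr pair; lia. Qed.

Lemma ribP th : th \in Th -> exists p q rho, ribbon_rows L th p q rho.
Proof.
move=> thin; have [rib cov _ _ _] := outer; apply: (@ribbon_rowsP L (part lam 1)); last exact: rib.
by move=> c cth; apply: (@in_skew_pos _ mu) => //; rewrite cov; apply/hasP; exists th.
Qed.

Lemma mem_rib k i th : th \in Th -> at_ k i \in th -> dcell D k i.
Proof. by move=> thin cth; have [_ cov _ _ _] := outer; rewrite -inD cov; apply/hasP; exists th. Qed.

Lemma ex_rib k i : dcell D k i -> exists2 th, th \in Th & at_ k i \in th.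
Proof. by have [_ cov _ _ _] := outer; rewrite -inD cov => /hasP. Qed.

Lemma rib_uniq c th th' : th \in Th -> th' \in Th -> c \in th -> c \in th' -> th = th'.
Proof.
have [_ _ dis _ _] := outer.
move=> /(nthP [::])[i lti <-] /(nthP [::])[j ltj <-] ci cj.
have [->//|/eqP ne] := eqVneq i j.
by have := dis i j lti ltj ne c ci; rewrite cj.
Qed.

Lemma rr_range th p q rho : th \in Th -> ribbon_rows L th p q rho ->
  (kmin D <= p)%N /\ (q <= kmax D)%N.
Proof.
move=> thin rr; have pq := rr_le rr.
have /(mem_rib thin)/dcell_bounds[? _ _ _] : at_ p (rho p) \in th by rewrite (rr_mem rr) leqnn pq eqxx.
have /(mem_rib thin)/dcell_bounds[_ ? _ _] : at_ q (rho q) \in th by rewrite (rr_mem rr) leqnn pq eqxx.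
by [].
Qed.

(** Such a cell has a neighbour above or to the right, so the exceptional clause of [goes_up]
    concerns the last diagonal only. *)
Lemma not_topright k i : dcell D k i -> (k < kmax D)%N ->
  at_ k i == top_right (skew_cells lam mu) = false.
Proof.
move=> Di lt; have := dnext_cell Di lt; have /andP[? ?] := dcell_pos Di.
have msk k' i' : (at_ k' i' \in skew_cells lam mu) = dcell D k' i'.
  by rewrite mem_skew_cells // inD.
have ne : skew_cells lam mu != [::].
  by apply/eqP => e; have := msk k i; rewrite e Di.
have [_ bB] := top_rightP ne.
move=> nx; apply/eqP => e; rewrite -e in bB.
case/orP: nx; rewrite -msk => /bB; rewrite /at_ /dcell_at /=; lia.
Qed.

Lemma goes_upE th p q rho k : th \in Th -> ribbon_rows L th p q rho ->
  (p <= k <= q)%N -> (k < kmax D)%N ->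
  goes_up lam mu th (at_ k (rho k)) =
    if (k < q)%N then rho k.+1 == (rho k).-1 else ~~ dcell D k.+1 (rho k).-1.
Proof.
move=> thin rr kr lt.
have cth : at_ k (rho k) \in th by rewrite (rr_mem rr) kr eqxx.
have Di := mem_rib thin cth; have /andP[? ?] := dcell_pos Di.
rewrite /goes_up not_topright // at_above // (rr_mem rr) /top_perim at_above // inD.
rewrite (rr_tail rr); case: ltnP => kq.
  rewrite (_ : (p <= k.+1)%N); last by lia.
  rewrite eq_sym (_ : (at_ k (rho k) == dcell_at L q (rho q)) = false) ?andFb ?orbF //.
  apply/negbTE/eqP => /(congr1 (diag_of L)); rewrite !dcell_atK //; first by lia.
  by have /andP[] := rr_pos rr (ltac:(lia) : p <= q <= q)%N.
have -> : k = q by lia.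
by rewrite andbF /= eqxx.
Qed.

Lemma rib_diag1 th k i j : th \in Th -> at_ k i \in th -> at_ k j \in th -> i = j.
Proof.
move=> inth; have [p [q [rho rr]]] := ribP inth.
by rewrite !(rr_mem rr) => /andP[_ /eqP->] /andP[_ /eqP->].
Qed.

Lemma goes_up_step th k i : th \in Th -> at_ k i \in th -> (k < kmax D)%N ->
  goes_up lam mu th (at_ k i) =
    (at_ k.+1 i.-1 \in th) || (at_ k.+1 i \notin th) && ~~ dcell D k.+1 i.-1.
Proof.
move=> inth cth lt; have [p [q [rho rr]]] := ribP inth.
have /andP[/andP[i0 _] _] := dcell_pos (mem_rib inth cth).
move: cth; rewrite (rr_mem rr) => /andP[kr /eqP iE]; rewrite {1}iE (goes_upE inth rr) // !(rr_mem rr) -iE.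
case/andP: kr => pk kq; rewrite (leq_trans pk (leqnSn k)) /=.
case: (ltnP k q) => //= lkq.
have /andP[s1 s2] : (rho k.+1 <= i <= (rho k.+1).+1)%N.
  by rewrite iE; apply: (rr_step rr); rewrite pk.
rewrite eq_sym; case: eqP => //= n1.
by have -> : i == rho k.+1 by clear - s1 s2 n1 i0; lia.
Qed.

(** A cell whose ribbon continues neither up nor right is the tail, which lies on the top or right
    perimeter. *)
Lemma outer_step th k i : th \in Th -> at_ k i \in th ->
  at_ k.+1 i.-1 \notin th -> at_ k.+1 i \notin th -> ~~ (dcell D k.+1 i.-1 && dcell D k.+1 i).
Proof.
move=> inth cth nu nr; have Di := mem_rib inth cth.
have /andP[/andP[i0 _] _] := dcell_pos Di.
have [p [q [rho rr]]] := ribP inth; have [_ _ _ _ outt] := outer.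
have := outt th inth; move: cth nu nr; rewrite !(rr_mem rr) => /andP[/andP[pk kq] /eqP iE].
rewrite (leq_trans pk (leqnSn k)) /=.
case: (ltnP k q) => [lkq|qk] /= n1 n2.
  have /andP[s1 s2] : (rho k.+1 <= i <= (rho k.+1).+1)%N.
    by rewrite iE; apply: (rr_step rr); rewrite pk.
  by clear - s1 s2 n1 n2 i0; lia.
have kE : k = q by apply/eqP; rewrite eqn_leq kq.
rewrite (rr_tail rr) -kE -iE -/at_ /top_perim /right_perim at_above // at_right // !inD.
by rewrite negb_and.
Qed.

(** A cell with both a left and a lower neighbour in the shape is on neither perimeter allowed for
    heads, so its ribbon has a previous cell. *)
Lemma rib_pred th k i : th \in Th -> at_ k.+1 i \in th -> dcell D k i -> dcell D k i.+1 ->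
  (at_ k i \in th) || (at_ k i.+1 \in th).
Proof.
move=> inth cth D1 D2.
have [p [q [rho rr]]] := ribP inth; have [_ _ _ outh _] := outer.
have := outh th inth; move: cth; rewrite !(rr_mem rr) => /andP[/andP[pk kq] /eqP iE].
rewrite (ltnW kq) andbT; case: (leqP p k) => [lpk _|kp] /=.
  have /andP[s1 s2] : (rho k.+1 <= rho k <= (rho k.+1).+1)%N by apply: (rr_step rr); rewrite lpk.
  by rewrite -iE in s1 s2; clear - s1 s2; lia.
have kE : p = k.+1 by apply/eqP; rewrite eqn_leq pk.
by rewrite (rr_head rr) kE -iE -/at_ /left_perim /bottom_perim -at_left -at_below !inD D1 D2.
Qed.

(* A cell between two consecutive cells of a diagonal cannot be a head, so its
   ribbon comes from exactly one of the two. *)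
Lemma same_direction1 k i th1 th2 : dcell D k i -> dcell D k i.+1 -> (k < kmax D)%N ->
  th1 \in Th -> th2 \in Th -> at_ k i \in th1 -> at_ k i.+1 \in th2 ->
  goes_up lam mu th1 (at_ k i) = goes_up lam mu th2 (at_ k i.+1).
Proof.
move=> D1 D2 lt in1 in2 c1 c2.
have Dm := dcell_between D1 D2 lt; have [th inth cm] := ex_rib Dm.
have /andP[/andP[i0 _] _] := dcell_pos D1.
rewrite !goes_up_step //= Dm andbF orbF.
have -> : (at_ k.+1 i.-1 \in th1) || (at_ k.+1 i \notin th1) && ~~ dcell D k.+1 i.-1 =
          (at_ k.+1 i \notin th1).
  have [m1|m1] /= := boolP (at_ k.+1 i \in th1).
    by rewrite orbF; apply/negP => /(rib_diag1 in1 m1) e; clear - i0 e; lia.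
  have [//|u1] /= := boolP (at_ k.+1 i.-1 \in th1).
  by have := outer_step in1 c1 u1 m1; rewrite Dm andbT.
case/orP: (rib_pred inth cm D1 D2) => ck.
  have e1 := rib_uniq inth in1 ck c1; rewrite -e1 cm; apply/esym/negP => m2.
  have e2 := rib_uniq in2 inth m2 cm; rewrite e2 in c2.
  by have := rib_diag1 inth ck c2; apply/eqP; rewrite ltn_eqF.
have e2 := rib_uniq inth in2 ck c2; rewrite -e2 cm; apply/negP => m1.
have e1 := rib_uniq in1 inth m1 cm; rewrite e1 in c1.
by have := rib_diag1 inth c1 ck; apply/eqP; rewrite ltn_eqF.
Qed.

Lemma same_direction k i j th1 th2 : dcell D k i -> dcell D k j -> (k < kmax D)%N ->
  th1 \in Th -> th2 \in Th -> at_ k i \in th1 -> at_ k j \in th2 ->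
  goes_up lam mu th1 (at_ k i) = goes_up lam mu th2 (at_ k j).
Proof.
wlog ij : i j th1 th2 / (i <= j)%N.
  by move=> H Di Dj lt in1 in2 c1 c2; case: (leqP i j) => [|/ltnW] ij; [|symmetry]; apply: H.
rewrite -(subnKC ij); elim: (j - i)%N th2 => [|d IH] th2 Di Dj lt in1 in2 c1 c2.
  by rewrite addn0 in Dj c2 *; rewrite (rib_uniq in1 in2 c1 c2).
rewrite addnS in Dj c2 *.
have Dj' : dcell D k (i + d) by move: Di Dj; rewrite /dcell; lia.
have [th inth cth] := ex_rib Dj'.
by rewrite (IH th) //; apply: same_direction1.
Qed.

(** Vertex [w] follows diagonal [w.-1], whose cells have content [w.-1 + r - 1]. *)
Definition goes_right_at (w : nat) := ~~ content_goes_up lam mu r Th (w.-1%:Z + r - 1).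
Let U := goes_right_at.

Lemma content_at k i : dcell D k i -> content lam r (at_ k i) = k%:Z + r - 1.
Proof. by move/dcell_pos => ?; rewrite contentE // /at_ /=; rewrite -/L; lia. Qed.

(** By [same_direction] the existential test on a content can be read off any one cell. *)
Lemma turnE k i th : dcell D k i -> (k < kmax D)%N -> th \in Th -> at_ k i \in th ->
  U k.+1 = ~~ goes_up lam mu th (at_ k i).
Proof.
move=> Di lt inth cth; congr (~~ _); apply/hasP/idP => [[g]|up].
  rewrite mem_skew_cells // => /[dup] gin /(in_skew_pos pl) /andP[g1 /andP[g2 _]] /=.
  rewrite -(diag_ofK g1 g2) -/L -/at_ in gin *.
  have Dg : dcell D (diag_of L g) g.1 by rewrite -inD.
  rewrite content_at // => /andP[/eqP ck /hasP[th' inth' /andP[cth' up]]].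
  have kE : diag_of L g = k by clear - ck; lia.
  by rewrite kE in Dg cth' up; rewrite (same_direction Di Dg lt inth inth').
exists (at_ k i); first by rewrite mem_skew_cells // inD.
by rewrite content_at // eqxx /=; apply/hasP; exists th => //; rewrite cth up.
Qed.

(** Inside the ribbon the direction is that of its next cell. At the tail it is up if the cell above
    is missing, and right otherwise, when the perimeter condition makes the right cell missing:
    either way the strand leaves the shape. *)
Lemma rib_next th p q rho k : th \in Th -> ribbon_rows L th p q rho ->
  (p <= k <= q)%N -> (k < kmax D)%N ->
  dcell D k.+1 (dnext U k (rho k)) = (k < q)%N /\
  ((k < q)%N -> dnext U k (rho k) = rho k.+1).
Proof.
move=> thin rr kr lt.
have cth : at_ k (rho k) \in th by rewrite (rr_mem rr) kr eqxx.
have Di := mem_rib thin cth.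
rewrite /dnext (turnE Di lt thin cth) (goes_upE thin rr) //.
have [_ _ _ _ outt] := outer.
have := dcell_pos Di => /andP[/andP[i0 _] _].
case: (ltnP k q) => kq; last first.
  split=> //; have kE : k = q by lia.
  have := outt th thin; rewrite (rr_tail rr) -/at_ -kE /top_perim /right_perim at_above // at_right // !inD.
  by case: (boolP (dcell D k.+1 (rho k).-1)) => [_ /= /negbTE|/negbTE->].
have st := rr_step rr (ltac:(lia) : p <= k < q)%N.
have nE : (if rho k.+1 != (rho k).-1 then rho k else (rho k).-1) = rho k.+1.
  by case: eqP => /=; lia.
rewrite nE; split=> //; apply: (mem_rib thin); rewrite (rr_mem rr) eqxx; lia.
Qed.

Lemma dstart_rib th p q rho k : th \in Th -> ribbon_rows L th p q rho ->
  (p <= k <= q)%N -> dstart D U k (rho k) = p.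
Proof.
move=> thin rr; have [minp qmax] := rr_range thin rr.
have D_ j : (p <= j <= q)%N -> dcell D j (rho j).
  by move=> jr; apply: (mem_rib thin); rewrite (rr_mem rr) jr eqxx.
move=> /andP[pk]; rewrite -(subnKC pk); elim: (k - p)%N => [|d IH].
  rewrite addn0 => pq; have pr : (p <= p <= q)%N by rewrite leqnn.
  have := D_ p pr; case: p rr pr {minp D_ pk pq} => [|p] rr pr Dp //.
  rewrite [dstart _ _ _ _]/=; set i' := (if U p.+1 then rho p.+1 else (rho p.+1).+1); case: ifP => // Dp'.
  (* If the strand reached back beyond the head, the ribbon of the earlier cell would continue into
     the head by [rib_next], hence be [th] itself, which has no cell on that diagonal. *)
  have [th' inth' cth'] := ex_rib Dp'.
  have [p' [q' [rho' rr']]] := ribP inth'.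
  have := cth'; rewrite (rr_mem rr') => /andP[pr' /eqP e'].
  have ltp : (p < kmax D)%N by have [] := dcell_bounds Dp; lia.
  have [dn dn'] := rib_next inth' rr' pr' ltp.
  have nE : dnext U p (rho' p) = rho p.+1.
    by rewrite -e' /dnext /i'; case: (U p.+1).
  rewrite nE Dp in dn; have e'' := dn' (esym dn); rewrite nE in e''.
  have cin : at_ p.+1 (rho p.+1) \in th' by rewrite (rr_mem rr') e'' eqxx; lia.
  have thE : th' = th by apply: (rib_uniq inth' thin cin); rewrite (rr_mem rr) pr eqxx.
  by move: cth'; rewrite thE (rr_mem rr) ltnn.
rewrite addnS => pq; have kr : (p <= p + d <= q)%N by lia.
have [_ /(_ ltac:(lia)) nE] := rib_next thin rr kr (ltac:(lia) : p + d < kmax D)%N.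
have := dcell_pos (D_ _ kr) => /andP[/andP[i0 _] _].
rewrite /= -nE /dnext; case: (U (p + d).+1); rewrite ?prednK // D_ //; apply: IH; lia.
Qed.

Definition rib_start th := diag_of L (rib_head th).
Definition rib_end th := (diag_of L (rib_tail th), (rib_tail th).1).

Lemma rib_startE th p q rho : ribbon_rows L th p q rho -> rib_start th = p.
Proof.
move=> rr; rewrite /rib_start (rr_head rr) dcell_atK //.
have pr : (p <= p <= q)%N by rewrite leqnn (rr_le rr).
by have /andP[] := rr_pos rr pr.
Qed.

Lemma rib_endE th p q rho : ribbon_rows L th p q rho -> rib_end th = (q, rho q).
Proof.
move=> rr; rewrite /rib_end (rr_tail rr) dcell_atK //.
have qr : (p <= q <= q)%N by rewrite leqnn (rr_le rr).
by have /andP[] := rr_pos rr qr.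
Qed.

Lemma Th_uniq : uniq Th.
Proof.
have [rib _ dis _ _] := outer.
apply/(uniqP [::]) => i j; rewrite !inE => lti ltj e.
have [->//|/eqP ne] := eqVneq i j.
have [ne0 _ _ _] := rib _ (mem_nth [::] lti).
case: (nth [::] Th i) (dis i j lti ltj ne) e ne0 => // c s dc e _.
by have := dc c; rewrite -e inE eqxx => /(_ isT).
Qed.

Lemma perm_ribbons :
  perm_eq [seq (rib_start th, (rib_end th).1.+1) | th <- Th] (dpairs D U).
Proof.
apply: perm_dpairs => //.
- rewrite map_inj_in_uniq ?Th_uniq // => th th' inth inth'.
  have [p [q [rho rr]]] := ribP inth; have [p' [q' [rho' rr']]] := ribP inth'.
  rewrite (rib_endE rr) (rib_endE rr') => -[qE rE].
  have pq := rr_le rr; have pq' := rr_le rr'.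
  apply: (@rib_uniq (at_ q (rho q))) => //; first by rewrite (rr_mem rr) eqxx; lia.
  by rewrite (rr_mem rr') rE -qE eqxx; lia.
- case=> k i /=; apply/mapP/andP => [[th inth]|[Di nD]].
    have [p [q [rho rr]]] := ribP inth; rewrite (rib_endE rr) => -[-> ->].
    have pq := rr_le rr; have qr : (p <= q <= q)%N by lia.
    split; first by apply: (mem_rib inth); rewrite (rr_mem rr) qr eqxx.
    have [_ qmax] := rr_range inth rr.
    have [lt|ge] := ltnP q (kmax D); last first.
      by apply/negP => /dcell_bounds[_ ? _ _]; lia.
    by have [-> _] := rib_next inth rr qr lt; rewrite ltnn.
  have [th inth cth] := ex_rib Di; exists th => //.
  have [p [q [rho rr]]] := ribP inth; rewrite (rib_endE rr).
  move: cth nD; rewrite (rr_mem rr) => /andP[kr /eqP iE]; rewrite iE => nD.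
  suff -> : k = q by [].
  have [_ qmax] := rr_range inth rr; have [_ kmx _ _] := dcell_bounds Di.
  have [lt|ge] := ltnP k (kmax D); last by lia.
  by have [dn _] := rib_next inth rr kr lt; rewrite dn in nD; lia.
- move=> th inth; have [p [q [rho rr]]] := ribP inth.
  rewrite (rib_endE rr) (rib_startE rr) /= (dstart_rib inth rr) //.
  by have := rr_le rr; lia.
Qed.

End Decomposition.

(** * Sub-ribbons of the cutting strip *)

Lemma esup0 (R : comNzRingType) (x w : seq R) : esup x w 0 = 1.
Proof.
have e0 (s : seq R) : Defs.esym s 0 = 1 by elim: s => //= c s ->; rewrite addr0.
have h0 (s : seq R) : hsym s 0 = 1 by elim: s => //= c s IH; rewrite big_ord1 expr0 mul1r subn0 IH.
by rewrite -[0]/(Posz 0) /esup big_ord1 e0 h0 expr0 !mul1r.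
Qed.

Lemma esup_neg (R : comNzRingType) (x w : seq R) (n : int) : n < 0 -> esup x w n = 0.
Proof. by case: n. Qed.

(** Zeros are allowed in [s]: the inner shape of a strip has empty columns. *)
Lemma conj_conjseq s k : sorted geq s -> (0 < k)%N -> conj (conjseq s) k = nth 0%N s k.-1.
Proof.
move=> srt k0; rewrite /conj /conjseq count_map.
rewrite (@eq_in_count _ _ (fun j => j <= part s k)%N); last first.
  by move=> j; rewrite mem_iota => jr /=; rewrite conj_le_geq //; lia.
rewrite -/(part s k) -[RHS](size_iota 1).
have le : (part s k <= head 0 s)%N by rewrite -nth0; apply: (part_geq (i := 1)).
rewrite -{1}(subnKC le) iotaD count_cat -[RHS]addn0; congr addn.
  by apply/eqP; rewrite -all_count; apply/allP => j; rewrite mem_iota; lia.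
by apply/eqP; rewrite -leqn0 leqNgt -has_count; apply/hasP => -[j]; rewrite mem_iota; lia.
Qed.

Section Kernel.
Variables (R : comNzRingType) (y z : int -> R) (lam mu : seq nat) (r : int).
Variables (a b : nat -> int).

Definition flag_a (c : int) : int :=
  let m := leftmost_of_content lam mu r c in
  a (Defs.col m) - ((conj mu (Defs.col m))%:Z + 1) + (Defs.row m)%:Z.
Definition flag_b (c : int) : int :=
  let M := rightmost_of_content lam mu r c in
  b (Defs.col M) - (conj lam (Defs.col M))%:Z + (Defs.row M)%:Z.

Definition ct (k : nat) : int := k%:Z + r - 1.

(* The entry of a Jacobi-Trudi matrix whose row is a vertical strip starting on
   diagonal s and whose column is a vertical strip ending on diagonal t - 1. *)
Definition ker (s t : nat) : R :=
  esup [seq y u | u <- zrange (flag_a (ct t.-1)) (flag_b (ct s))]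
       [seq z u | u <- zrange (flag_a (ct t.-1) + ct t.-1) (flag_b (ct s) + ct s)]
       (t%:Z - s%:Z).

Lemma ker1 s : ker s s = 1.
Proof. by rewrite /ker subrr esup0. Qed.

Lemma ker0 s t : (t < s)%N -> ker s t = 0.
Proof. by move=> ts; rewrite /ker esup_neg //; lia. Qed.

Variable Th : seq (seq cell).
Let U := goes_right_at lam mu r Th.

Section Strip.
Variables (p q : nat).
Hypothesis pq : (p <= q)%N.

(** [W] lists the diagonals which the cutting strip leaves to the right; [T] and [B] are the
    diagonals of the tops and bottoms of its vertical strips. *)
Let W := [seq w <- iota p (q - p) | U w.+1].
Let T := rcons W q.
Let B := p :: map S W.

Lemma strip_rightsE : strip_rights lam mu r Th (ct p) (ct q) = [seq ct w | w <- W].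
Proof.
have zr : zrange (ct p) (ct q - 1) = [seq ct w | w <- iota p (q - p)].
  rewrite /zrange; case: ifP => le; last first.
    by rewrite (_ : (q - p = 0)%N) //; move: le; rewrite /ct; lia.
  have -> : (absz (ct q - 1 - ct p)%R).+1 = (q - p)%N by move: le; rewrite /ct; lia.
  have -> : iota p (q - p) = [seq (p + k)%N | k <- iota 0 (q - p)] by rewrite -iotaDl addn0.
  rewrite -map_comp; apply: eq_map => k /=.
  by rewrite /ct PoszD; ring.
by rewrite /strip_rights zr filter_map.
Qed.

Lemma breaksE v : (q <= v)%N -> breaks U v p q.+1 = map S W.
Proof.
move=> qv; rewrite /breaks -(subnKC (_ : (p.+1 + (q - p) <= v.+1)%N)); last by lia.
rewrite -addnA iotaD filter_cat iotaD filter_cat !add0n.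
rewrite (@eq_in_filter _ _ pred0) ?filter_pred0 ?cat0s; last first.
  by move=> u; rewrite mem_iota => ur; apply/negbTE; rewrite negb_and; apply/orP; left; lia.
rewrite [X in _ ++ X](@eq_in_filter _ _ pred0) ?filter_pred0 ?cats0; last first.
  by move=> u; rewrite mem_iota => ur; apply/negbTE; rewrite andbA negb_and; apply/orP; left; lia.
rewrite (@eq_in_filter _ _ U); last by move=> u; rewrite mem_iota => ur; rewrite andbA andb_idl //; lia.
by rewrite -(addn1 p) addnC iotaDl filter_map.
Qed.

Lemma strip_sorted : sorted ltn T /\ sorted ltn B.
Proof.
have sW : sorted ltn W by apply: sorted_filter; [exact: ltn_trans|exact: iota_ltn_sorted].
have rW w : w \in W -> (p <= w < q)%N by rewrite mem_filter mem_iota; lia.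
split.
  rewrite /T (sorted_pairwise ltn_trans) pairwise_rcons -(sorted_pairwise ltn_trans) sW andbT.
  by apply/allP => w /rW /andP[].
rewrite /B /= (path_sortedE ltn_trans); apply/andP; split.
  by apply/allP => u /mapP[w /rW /andP[pw _] ->]; rewrite /= ltnS.
by rewrite sorted_map; apply: sub_sorted sW.
Qed.

Let K := (size W).+1.

Lemma sorted_ltn_gap s i j : sorted ltn s -> (i <= j < size s)%N ->
  (nth 0 s i + (j - i) <= nth 0 s j)%N.
Proof.
move=> srt /andP[ij]; rewrite -(subnKC ij) addKn.
elim: (j - i)%N => [|d IH] js; first by rewrite !addn0.
rewrite !addnS in js *.
have := sorted_ltn_nth ltn_trans 0%N srt (i + d)%N (i + d).+1.
rewrite !inE js (ltnW js) ltnSn => /(_ isT isT isT) lt.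
by apply: leq_ltn_trans lt; apply: IH; apply: ltnW.
Qed.

Lemma sizeT : size T = K. Proof. by rewrite size_rcons. Qed.
Lemma sizeB : size B = K. Proof. by rewrite /= size_map. Qed.

Lemma nth_T_le i : (i < K)%N -> (nth 0 T i + (K.-1 - i) <= q)%N.
Proof.
move=> iK; have := @sorted_ltn_gap T i K.-1 (proj1 strip_sorted).
rewrite sizeT (_ : (i <= K.-1 < K)%N) => [/(_ isT)|]; last by lia.
by rewrite (_ : nth 0%N T K.-1 = q) // /T /K /= nth_rcons ltnn eqxx.
Qed.

Lemma nth_B_le_T i : (i < K)%N -> (nth 0 B i <= nth 0 T i)%N.
Proof.
rewrite /K ltnS; case: i => [|i] iK; rewrite /T nth_rcons /=.
  case: (posnP (size W)) => [->|W0] //; have : nth 0%N W 0 \in W by rewrite mem_nth.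
  by rewrite mem_filter mem_iota; lia.
rewrite (nth_map 0%N) //.
case: (ltngtP i.+1 (size W)) iK => // [lt _|e _].
  have [sT _] := strip_sorted; have := @sorted_ltn_gap T i i.+1 sT.
  rewrite sizeT (_ : (i <= i.+1 < K)%N) => [/(_ isT)|]; last by rewrite /K; lia.
  by rewrite /T !nth_rcons lt (ltnW lt) subSnn addn1.
have : nth 0%N W i \in W by rewrite mem_nth // -e.
by rewrite mem_filter mem_iota; lia.
Qed.

Lemma strip_KE : strip_K lam mu r Th (ct p) (ct q) = K.
Proof. by rewrite /strip_K /strip_tops size_rcons strip_rightsE size_map. Qed.

(** Column lengths of the strip as natural numbers. The additive equations in [lamcE] and [mucE]
    record that the subtractions do not truncate. *)
Let lamc i := (i.+1 + q.+1 - K - nth 0 B i)%N.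
Let muc i := (i.+1 + q - K - nth 0 T i)%N.

Lemma lamcE i : (i < K)%N ->
  nth 0%N (strip_lamc lam mu r Th (ct p) (ct q)) i = lamc i /\
  (lamc i + nth 0 B i + K = i.+1 + q.+1)%N.
Proof.
move=> iK; have := nth_T_le iK; have := nth_B_le_T iK => le1 le2.
have e : (lamc i + nth 0 B i + K = i.+1 + q.+1)%N by rewrite /lamc; lia.
split=> //; rewrite /strip_lamc strip_KE (nth_map 0%N) ?size_iota // nth_iota // /strip_height strip_KE.
have -> : nth 0 (strip_bots lam mu r Th (ct p) (ct q)) (1 + i).-1 = ct (nth 0%N B i).
  rewrite /strip_bots strip_rightsE -map_comp add1n /=.
  have -> : ct p :: [seq ((fun c => c + 1) \o ct) w | w <- W] = [seq ct w | w <- B].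
    by rewrite /B /= -map_comp; congr cons; apply: eq_map => w /=; rewrite /ct; lia.
  by rewrite (nth_map 0%N) // sizeB.
by rewrite /ct; lia.
Qed.

Lemma mucE i : (i < K)%N ->
  nth 0%N (strip_muc lam mu r Th (ct p) (ct q)) i = muc i /\
  (muc i + nth 0 T i + K = i.+1 + q)%N.
Proof.
move=> iK; have := nth_T_le iK => le2.
have e : (muc i + nth 0 T i + K = i.+1 + q)%N by rewrite /muc; lia.
split=> //; rewrite /strip_muc strip_KE (nth_map 0%N) ?size_iota // nth_iota // /strip_height strip_KE.
have -> : nth 0 (strip_tops lam mu r Th (ct p) (ct q)) (1 + i).-1 = ct (nth 0%N T i).
  by rewrite /strip_tops strip_rightsE -map_rcons add1n /= (nth_map 0%N) // sizeT.
by rewrite /ct; lia.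
Qed.

Lemma nth_sorted_lt s i : sorted ltn s -> (i.+1 < size s)%N -> (nth 0 s i < nth 0 s i.+1)%N.
Proof. by move=> srt lt; apply: (sorted_ltn_nth ltn_trans) => //; rewrite inE ltnW. Qed.

(** The matrix of a sub-ribbon has rows indexed by the bottoms and columns by the tops of its
    vertical strips, with tops shifted by one; these are also the breaks occurring in [rk]. *)
Lemma flaggedS_strip :
  flaggedS y z (strip_lam lam mu r Th (ct p) (ct q)) (strip_mu lam mu r Th (ct p) (ct q)) (ct p)
    (strip_K lam mu r Th (ct p) (ct q))
    (induced_a lam mu r Th a (ct p) (ct q)) (induced_b lam mu r Th b (ct p) (ct q)) =
  dlist ker (zip B (map S T)).
Proof.
have [sT sB] := strip_sorted.
have szz : size (zip B (map S T)) = K by rewrite size_zip size_map sizeT sizeB minnn.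
have conjl i : (i < K)%N -> conj (strip_lam lam mu r Th (ct p) (ct q)) i.+1 = lamc i.
  move=> iK; rewrite /strip_lam conj_conjseq //; first by case: (lamcE iK).
  apply/(sortedP 0%N) => j; rewrite size_map size_iota strip_KE => jK.
  have [-> e1] := lamcE jK; have [-> e2] := lamcE (ltnW jK).
  have := @nth_sorted_lt B j sB; rewrite sizeB => /(_ jK) lt.
  by clear - e1 e2 lt; rewrite /=; lia.
have conjm i : (i < K)%N -> conj (strip_mu lam mu r Th (ct p) (ct q)) i.+1 = muc i.
  move=> iK; rewrite /strip_mu conj_conjseq //; first by case: (mucE iK).
  apply/(sortedP 0%N) => j; rewrite size_map size_iota strip_KE => jK.
  have [-> e1] := mucE jK; have [-> e2] := mucE (ltnW jK).
  have := @nth_sorted_lt T j sT; rewrite sizeT => /(_ jK) lt.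
  by clear - e1 e2 lt; rewrite /=; lia.
have tops : strip_tops lam mu r Th (ct p) (ct q) = map ct T.
  by rewrite /strip_tops strip_rightsE -map_rcons.
have bots : strip_bots lam mu r Th (ct p) (ct q) = map ct B.
  rewrite /strip_bots strip_rightsE /B /= -!map_comp; congr cons.
  by apply: eq_map => w /=; rewrite /ct; lia.
rewrite /flaggedS /dlist strip_KE szz; congr (\det _); apply/matrixP => i j; rewrite !mxE.
have iK := ltn_ord i; have jK := ltn_ord j.
rewrite !nth_zip ?size_map ?sizeT ?sizeB //= (nth_map 0%N) ?sizeT //.
have [_ el] := lamcE iK; have [_ em] := mucE jK; have [_ el0] := lamcE (ltn0Sn _ : (0 < K)%N).
rewrite /ker /conj_flag_a /conj_flag_b /content /Defs.row /Defs.col /= !conjl // ?conjm //.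
have nthT : nth 0 (strip_tops lam mu r Th (ct p) (ct q)) j.+1.-1 = ct (nth 0%N T j).
  by rewrite tops (nth_map 0%N) ?sizeT.
have nthB : nth 0 (strip_bots lam mu r Th (ct p) (ct q)) i.+1.-1 = ct (nth 0%N B i).
  by rewrite bots (nth_map 0%N) ?sizeB.
rewrite /induced_a /induced_b nthT nthB -/(flag_a _) -/(flag_b _).
(* With root content [ct p], the strip's own shifted contents agree with those of the diagonals of
   the shape. *)
have -> : (j.+1%:Z - (muc j).+1%:Z + ct p - 1 + (lamc 0)%:Z) = ct (nth 0%N T j).
  by move: el0 em; rewrite /ct /=; lia.
have -> : (i.+1%:Z - (lamc i)%:Z + ct p - 1 + (lamc 0)%:Z) = ct (nth 0%N B i).
  by move: el0 el; rewrite /ct /=; lia.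
by congr esup; clear - el em; lia.
Qed.

End Strip.

(** The conventions for empty and undefined sub-ribbons are values of the kernel: without breaks
    [rk] is [ker], which is 1 on the diagonal and 0 below it. *)
Lemma ribbon_entryE thi thj p q v :
  content lam r (rib_head thi) = ct p -> content lam r (rib_tail thj) = ct q -> (q <= v)%N ->
  ribbon_entry y z lam mu r Th a b thi thj = rk ker U v p q.+1.
Proof.
move=> hE tE qv; rewrite /ribbon_entry hE tE.
have [pq|qp] := leqP p q; last first.
  rewrite rk_nobreak; last by move=> u _ /andP[? ?]; lia.
  case: eqP => [e|ne]; first by rewrite (_ : p = q.+1) ?ker1 //; move: e; rewrite /ct; lia.
  rewrite ifT; last by move: ne; rewrite /ct; lia.
  by rewrite ker0 //; move: ne; rewrite /ct; lia.
rewrite ifF; last by apply/eqP; rewrite /ct; lia.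
rewrite ifF; last by apply/negbTE; rewrite /ct; lia.
by rewrite flaggedS_strip // /rk breaksE // -map_rcons.
Qed.

End Kernel.

(** * Columns *)

Section Columns.
Variables (R : comNzRingType) (y z : int -> R) (lam mu : seq nat) (r : int).
Variables (n : nat) (a b : nat -> int).
Hypotheses (pl : is_partition lam) (pm : is_partition mu) (sub : subpart mu lam).
Hypothesis hn : (part lam 1 <= n)%N.
Let L := size lam.

Lemma conj_anti s i j : (i <= j)%N -> (conj s j <= conj s i)%N.
Proof. by move=> ij; apply: sub_count => x /= jx; apply: leq_trans jx. Qed.

Lemma subpart_conj j : (0 < j)%N -> (conj mu j <= conj lam j)%N.
Proof.
move=> j0; case: (posnP (conj mu j)) => [->//|c0].
rewrite conj_le_geq ?partition_sorted //; apply: leq_trans (sub _).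
by rewrite -conj_le_geq ?partition_sorted.
Qed.

(** Any cell of the same content further left would force, by convexity, the upper left neighbour of
    [c] into the shape. *)
Lemma leftmost_of_contentE c : in_skew lam mu c -> ~~ in_skew lam mu (c.1.-1, c.2.-1) ->
  leftmost_of_content lam mu r (content lam r c) = c.
Proof.
move=> Pc nP; set S := [seq g <- skew_cells lam mu | content lam r g == content lam r c].
have cS : c \in S by rewrite mem_filter eqxx mem_skew_cells.
pose f (x acc : cell) := (x.2 < acc.2)%N.
have irr x : ~~ f x x by rewrite /f ltnn.
have tr x u v : f x u -> f u v -> f x v by rewrite /f; apply: ltn_trans.
have ne : S != [::] by apply/eqP => e; rewrite e in cS.
have [mS mB] := bestP irr tr ne; rewrite -[LHS]/(best f S).
move: (best f S) mS (mB _ cS) => m; rewrite mem_filter mem_skew_cells // => /andP[/eqP e Pm].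
rewrite /f -leqNgt => le; move: e; rewrite /content /Defs.row /Defs.col => e.
have /andP[m1 m2] := in_skew_pos pl Pm.
have e' : (m.2 + c.1 = c.2 + m.1)%N by clear - e; lia.
have [e2|n2] := eqVneq m.2 c.2; first by rewrite [m]surjective_pairing [c]surjective_pairing; congr pair; clear - e' e2; lia.
by case/negP: nP; apply: (in_skew_conv pl pm Pm Pc) => /=; clear - e' le n2 m1 m2; lia.
Qed.

Lemma rightmost_of_contentE c : in_skew lam mu c -> ~~ in_skew lam mu (c.1.+1, c.2.+1) ->
  rightmost_of_content lam mu r (content lam r c) = c.
Proof.
move=> Pc nP; set S := [seq g <- skew_cells lam mu | content lam r g == content lam r c].
have cS : c \in S by rewrite mem_filter eqxx mem_skew_cells.
pose f (x acc : cell) := (acc.2 < x.2)%N.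
have irr x : ~~ f x x by rewrite /f ltnn.
have tr x u v : f x u -> f u v -> f x v by rewrite /f => xu uv; apply: ltn_trans xu.
have ne : S != [::] by apply/eqP => e; rewrite e in cS.
have [mS mB] := bestP irr tr ne; rewrite -[LHS]/(best f S).
move: (best f S) mS (mB _ cS) => m; rewrite mem_filter mem_skew_cells // => /andP[/eqP e Pm].
rewrite /f -leqNgt => le; move: e; rewrite /content /Defs.row /Defs.col => e.
have e' : (m.2 + c.1 = c.2 + m.1)%N by clear - e; lia.
have [e2|n2] := eqVneq m.2 c.2; first by rewrite [m]surjective_pairing [c]surjective_pairing; congr pair; clear - e' e2; lia.
by case/negP: nP; apply: (in_skew_conv pl pm Pc Pm) => /=; clear - e' le n2; lia.
Qed.

Definition nonempty_col j := (conj mu j < conj lam j)%N.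
Definition col_top j : cell := ((conj mu j).+1, j).
Definition col_bot j : cell := (conj lam j, j).

Lemma col_top_skew j : (0 < j)%N -> nonempty_col j -> in_skew lam mu (col_top j).
Proof. by move=> j0 ne; rewrite in_skew_conj // j0 ltnSn. Qed.

Lemma col_bot_skew j : (0 < j)%N -> nonempty_col j -> in_skew lam mu (col_bot j).
Proof. by move=> j0 ne; rewrite in_skew_conj // j0 leqnn andbT. Qed.

(** As the column lengths of [mu] weakly decrease, the top of a column is the leftmost cell of its
    content, and the correction in [flag_a] vanishes there. *)
Lemma flag_a_top j : (0 < j)%N -> nonempty_col j ->
  flag_a lam mu r a (content lam r (col_top j)) = a j.
Proof.
move=> j0 ne; rewrite /flag_a leftmost_of_contentE ?col_top_skew //.
  by rewrite /Defs.col /Defs.row /=; lia.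
by rewrite in_skew_conj //= (ltnNge _ (conj mu j)) conj_anti ?leq_pred ?andbF.
Qed.

Lemma flag_b_bot j : (0 < j)%N -> nonempty_col j ->
  flag_b lam mu r b (content lam r (col_bot j)) = b j.
Proof.
move=> j0 ne; rewrite /flag_b rightmost_of_contentE ?col_bot_skew //.
  by rewrite /Defs.col /Defs.row /=; lia.
by rewrite in_skew_conj //= (ltnNge _ (conj lam j.+1)) conj_anti ?andbF.
Qed.

Lemma ct_diag c : in_skew lam mu c -> content lam r c = ct r (diag_of L c).
Proof. by move/(in_skew_pos pl) => ?; rewrite contentE //; lia. Qed.

Definition kcol i j : R :=
  esup [seq y t | t <- zrange (a j) (b i)]
       [seq z t | t <- zrange (conj_flag_a lam mu r a j) (conj_flag_b lam mu r b i)]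
       ((conj lam i)%:Z - i%:Z - (conj mu j)%:Z + j%:Z).

Lemma flaggedS_dlist :
  flaggedS y z lam mu r n a b = dlist kcol [seq (i, i) | i <- iota 1 n].
Proof.
rewrite /dlist size_map size_iota; congr (\det _); apply/matrixP => i j; rewrite !mxE.
by rewrite !(nth_map 0%N) ?size_iota // !nth_iota //= !add1n.
Qed.

Lemma dlist_nonempty_col A s : all (leq 1) (A ++ s) -> sorted ltn (A ++ s) ->
  dlist kcol [seq (i, i) | i <- A ++ s] =
  dlist kcol [seq (i, i) | i <- A ++ [seq j <- s | nonempty_col j]].
Proof.
elim: s A => [|e s IH] A pos srt //=; rewrite -cat_rcons IH ?cat_rcons //.
case: ifP => // /negbT; rewrite -leqNgt => le.
have e0 : (0 < e)%N by apply: (allP pos); rewrite mem_cat inE eqxx orbT.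
have eE : conj lam e = conj mu e by apply/eqP; rewrite eqn_leq le subpart_conj.
set F := filter _ s.
have FS i : i \in F -> i \in s by rewrite mem_filter => /andP[].
have := srt; rewrite (sorted_pairwise ltn_trans) pairwise_cat /= => /and3P[/allrelP As _ /andP[/allP es _]].
have z0 i j : (e <= i)%N -> (j <= e)%N -> (j < i)%N -> kcol i j = 0.
  move=> ei je ji; rewrite /kcol esup_neg //.
  by have := conj_anti lam ei; have := conj_anti mu je; clear - eE ji; lia.
have kee : kcol e e = 1 by rewrite /kcol (_ : _ + _ = 0) ?esup0 //; clear - eE; lia.
rewrite !map_cat map_cons -cat1s !dlist_cat.
- by rewrite dlist1 /= kee mul1r.
- by move=> c d /mapP[i iF ->] /mapP[j jA ->]; have ei := es _ (FS _ iF); have je := As _ _ jA (mem_head _ _);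
    apply: z0 => /=; clear - ei je; lia.
- by move=> c d /mapP[i iF ->]; rewrite inE => /eqP-> /=; apply: z0 => //; [apply: ltnW|]; apply: es (FS _ iF).
- move=> c d; rewrite mem_cat inE => /orP[/eqP->|/mapP[i iF ->]] /mapP[j jA ->] /=.
    by have je := As _ _ jA (mem_head _ _); apply: z0 => //; apply: ltnW.
  have ei := es _ (FS _ iF); have je := As _ _ jA (mem_head _ _).
  by apply: z0; clear - ei je; lia.
Qed.

Lemma kcol_ker i j : (0 < i)%N -> (0 < j)%N -> nonempty_col i -> nonempty_col j ->
  kcol i j = ker y z lam mu r a b (diag_of L (col_bot i)) (diag_of L (col_top j)).+1.
Proof.
move=> i0 j0 ni nj; have top := col_top_skew j0 nj; have bot := col_bot_skew i0 ni.
rewrite /ker /= -!ct_diag // flag_a_top // flag_b_bot //.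
have := in_skew_pos pl top; have := in_skew_pos pl bot; rewrite -/L /= => t1 t2.
by congr esup; rewrite /diag_of /=; clear - t1 t2; lia.
Qed.

Definition cols := [seq j <- iota 1 n | nonempty_col j].

Lemma flaggedS_cols : flaggedS y z lam mu r n a b =
  dlist (ker y z lam mu r a b)
    [seq (diag_of L (col_bot j), (diag_of L (col_top j)).+1) | j <- cols].
Proof.
rewrite flaggedS_dlist (@dlist_nonempty_col [::]) ?iota_ltn_sorted //; last first.
  by apply/allP => j; rewrite mem_iota => /andP[].
rewrite /dlist !size_map; congr (\det _); apply/matrixP => i j; rewrite !mxE.
rewrite !(nth_map 0%N) ?ltn_ord //=.
have inc (k : 'I_(size cols)) : (0 < nth 0 cols k)%N /\ nonempty_col (nth 0%N cols k).
  have : nth 0%N cols k \in cols by rewrite mem_nth.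
  by rewrite mem_filter mem_iota => /and3P[? ? _].
by rewrite kcol_ker; try (by case: (inc i)); case: (inc j).
Qed.

Section Diagonals.
Variable D : dshape.
Hypothesis okD : dshape_ok D.
Hypothesis inD : forall k i, in_skew lam mu (dcell_at L k i) = dcell D k i.

Lemma dstart_col k i : dcell D k i -> dstart D pred0 k i = diag_of L (col_bot (k + i - L)).
Proof.
elim: k i => [|k IH] i Di.
  by have := Di; rewrite -inD => /(in_skew_pos pl) /=; rewrite -/L; lia.
rewrite [LHS]/=; case: ifP => Di'; first by rewrite IH // addSnnS.
have := Di; rewrite -inD => Pi; have /andP[i1 j1] := in_skew_pos pl Pi; rewrite /= in i1 j1.
move: Pi Di'; rewrite -inD /dcell_at -addSnnS !in_skew_conj //.
by rewrite /diag_of /=; clear - i1 j1; rewrite -/L in i1 j1 *; lia.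
Qed.

(** Columns are the strands that always go up: they leave the shape at their top cells. *)
Lemma perm_cols :
  perm_eq [seq (diag_of L (col_bot j), (diag_of L (col_top j)).+1) | j <- cols] (dpairs D pred0).
Proof.
have colsP j : j \in cols -> (0 < j)%N /\ nonempty_col j.
  by rewrite mem_filter mem_iota => /and3P[? ? _].
have tK j : j \in cols -> dcell_at L (diag_of L (col_top j)) (col_top j).1 = col_top j.
  case/colsP => j0 nj; have /andP[c1 _] := in_skew_pos pl (col_top_skew j0 nj).
  by apply: diag_ofK.
pose tl j := (diag_of L (col_top j), (col_top j).1).
rewrite (_ : [seq _ | j <- cols] = [seq (diag_of L (col_bot j), (tl j).1.+1) | j <- cols]) //.
apply: perm_dpairs => //.
- rewrite map_inj_in_uniq ?filter_uniq ?iota_uniq // => i j ic jc [e1 e2].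
  by have := tK _ ic; rewrite e1 /= e2 -/((col_top j).1) tK // => -[].
- case=> k i /=; apply/mapP/andP => [[j jc [-> ->]]|[Di nD]].
    have [j0 nj] := colsP _ jc; have top := col_top_skew j0 nj.
    have /andP[c1 c2] := in_skew_pos pl top.
    split; first by rewrite -inD -/((col_top j).1) tK.
    rewrite -inD /dnext /dcell_at in_skew_conj //.
    have -> : ((diag_of L (col_top j)).+1 + (conj mu j).+1.-1 - L)%N = j.
      by rewrite /diag_of /=; clear - c1 c2; rewrite /= -/L in c1 c2; lia.
    by rewrite /= ltnn andbF.
  have := Di; rewrite -inD => Pi; have /andP[i1 j1] := in_skew_pos pl Pi; rewrite /= -/L in i1 j1.
  have jE : (k.+1 + i.-1 - L = k + i - L)%N by clear - i1; lia.
  move: Pi nD; rewrite -inD /dnext /dcell_at jE !in_skew_conj // => Pi nD.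
  exists (k + i - L)%N.
    rewrite mem_filter mem_iota /nonempty_col; clear - Pi j1 hn i1; lia.
  have iE : i = (conj mu (k + i - L)).+1 by clear - Pi nD i1 j1; lia.
  by rewrite /tl /= -iE; congr pair; rewrite /diag_of /=; clear - iE i1 j1; lia.
- move=> j jc; have [j0 nj] := colsP _ jc; have top := col_top_skew j0 nj.
  have e := tK _ jc; rewrite dstart_col; last by rewrite -inD /= -/((col_top j).1) tK.
  by congr (diag_of _ (col_bot _)); have := congr1 snd e.
Qed.

End Diagonals.
End Columns.

(** * The determinantal identity for outer ribbon decompositions *)

Unset Implicit Arguments.
Theorem theorem5p8 (R : comNzRingType) (y z : int -> R) (lam mu : seq nat) (r : int)
    (n : nat) (a b : nat -> int) (Th : seq (seq cell)) :
  is_partition lam -> is_partition mu -> subpart mu lam ->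
  edge_connected (in_skew lam mu) ->
  column_flags lam mu n a b ->
  outer_ribbon_decomposition lam mu Th ->
  flaggedS y z lam mu r n a b =
  \det (\matrix_(i < size Th, j < size Th)
          ribbon_entry y z lam mu r Th a b (nth [::] Th i) (nth [::] Th j)).
Proof.
move=> pl pm sub conn [hn _] outer.
rewrite flaggedS_cols //.
(* Diagonal coordinates require a cell, so the empty shape is treated apart. *)
have [ex|nex] : (exists c, in_skew lam mu c) \/ ~~ has (in_skew lam mu) (skew_cells lam mu).
- case: (boolP (has _ _)) => [/hasP[c _ Pc]|]; by [left; exists c|right].
- have [D okD inD] := @skew_dshape (in_skew lam mu) (size lam) (part lam 1)
    (fun c d e => @in_skew_conv lam mu c d e pl pm) (fun c => @in_skew_pos lam mu c pl) ex conn.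
  (* Columns become strands without horizontal steps, the sweep turns these into strands along [U],
     and the latter are the ribbons. *)
  rewrite (dlist_perm _ (perm_cols pl pm hn okD inD)).
  pose U := goes_right_at lam mu r Th.
  rewrite (sweep_dshape U okD (ker1 y z lam mu r a b) (@ker0 _ y z lam mu r a b)).
  rewrite -(dlist_perm _ (perm_ribbons r pl pm outer okD inD)).
  rewrite /dlist size_map; congr (\det _); apply/matrixP => i j; rewrite !mxE.
  rewrite !(nth_map [::]) //; apply/esym; cbn [fst snd].
  have ribs k : (k < size Th)%N -> exists p q rho, ribbon_rows (size lam) (nth [::] Th k) p q rho.
    by move=> kt; apply: (ribP pl outer); rewrite mem_nth.
  have [p [q [rho rr]]] := ribs i (ltn_ord i); have [p' [q' [rho' rr']]] := ribs j (ltn_ord j).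
  have inth k : (k < size Th)%N -> nth [::] Th k \in Th by move=> kt; rewrite mem_nth.
  have pq := rr_le rr; have pq' := rr_le rr'.
  have Dp : dcell D p (rho p) by apply: (mem_rib outer inD (inth _ (ltn_ord i))); rewrite (rr_mem rr) eqxx leqnn pq.
  have Dq : dcell D q' (rho' q') by apply: (mem_rib outer inD (inth _ (ltn_ord j))); rewrite (rr_mem rr') eqxx leqnn pq'.
  rewrite (rib_startE rr) (rib_endE rr'); apply: ribbon_entryE.
  + by rewrite (rr_head rr) (content_at r pl pm inD).
  + by rewrite (rr_tail rr') (content_at r pl pm inD).
  + by case/and4P: Dq => _ le _ _; apply: leqW.
(* In the empty shape there are neither nonempty columns nor ribbons, and both determinants have
   size 0. *)
- have -> : cols lam mu n = [::].
    apply/eqP; rewrite -size_eq0 size_filter -leqn0 leqNgt -has_count; apply/hasP => -[j].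
    rewrite mem_iota => /andP[j0 _] nj; case/hasP: nex; exists (col_top mu j); rewrite ?mem_skew_cells //; exact: col_top_skew.
  have [rib cov _ _ _] := outer.
  have -> : Th = [::].
    case: (Th) rib cov => // th Th' rib cov.
    have [ne _ _ _] := rib th (mem_head _ _); case: th ne rib cov => // c th _ rib cov.
    case/hasP: nex; exists c; rewrite ?mem_skew_cells //; by rewrite cov /= mem_head.
  by rewrite dlist_nil det_mx00.
Qed.
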